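(* Let $d\ge1$, $p\in(0,1)$, $\overline p=1-p$, $S\sim\mathrm{Ber}(p)$, and $(X\vert S=k)\sim\mathcal N(\mu_k,\sigma_k^2I)$ for $k\in\{0,1\}$, where $\mu_k\in\mathbb R^d$ and $\sigma_k>0$. Let $\sigma>0$ and $X^\sigma=X+\sigma Z$ with $Z\sim\mathcal N(0,I)$ independent of $(X,S)$. Let $\mathcal H=\{x\mapsto s(a^{\mathrm T}x+b'):a\in\mathbb R^d,b'\in\mathbb R\}$, and let $\epsilon_A$ and $\epsilon_A^{\mathrm{CCG}}$ be as defined in the context. Then $$\epsilon_A\le\epsilon_A^{\mathrm{CCG}}=\frac{(\sigma_1^2-\sigma_0^2)^2(q_1+q_2\sigma^2+q_3\sigma^4+2d\sigma^6)}{16(r_1+r_2\sigma^2+r_3\sigma^4+r_4\sigma^6+r_5\sigma^8+\sigma^{10})},$$ where, with $\|\cdot\|$ the Euclidean norm, $$\begin{aligned} q_1&=\|\mu_1-\mu_0\|^4(p^2\overline p\sigma_1^2+p\overline p^2\sigma_0^2)+2d\sigma_0^6-d^2p^3(\sigma_1^2-\sigma_0^2)^3+2p\overline p(2+d)\sigma_0^2\sigma_1^2\|\mu_1-\mu_0\|^2\\ &\quad+p^2\big(d(5d-2)\sigma_0^4\sigma_1^2-2d(2d+1)\sigma_0^2\sigma_1^4+d(2+d)\sigma_1^6-2d(d-1)\sigma_0^6\big)\\ &\quad+p\big(d(d-4)\sigma_0^6-2d(d-1)\sigma_0^4\sigma_1^2+d(2+d)\sigma_0^2\sigma_1^4\big),\\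 q_2&=p\overline p\|\mu_1-\mu_0\|^2\big(\|\mu_1-\mu_0\|^2+2(2+d)(\sigma_0^2+\sigma_1^2)\big)-p^2d(d-4)(\sigma_1^2-\sigma_0^2)^2\\ &\quad+p\big(d(d-10)\sigma_0^4-2d(d-4)\sigma_0^2\sigma_1^2+d(2+d)\sigma_1^4\big)+6d\sigma_0^4,\\ q_3&=2p\overline p(2+d)\|\mu_1-\mu_0\|^2+6d(p\sigma_1^2+\overline p\sigma_0^2),\\ r_1&=\sigma_0^4\sigma_1^4\big(p\overline p\|\mu_1-\mu_0\|^2+p\sigma_1^2+\overline p\sigma_0^2\big),\\ r_2&=\sigma_0^2\sigma_1^2\big(2p\overline p(\sigma_1^2+\sigma_0^2)\|\mu_1-\mu_0\|^2+2p\sigma_1^4+2\overline p\sigma_0^4+3\sigma_0^2\sigma_1^2\big),\\ r_3&=p\overline p(\sigma_0^4+4\sigma_0^2\sigma_1^2+\sigma_1^4)\|\mu_1-\mu_0\|^2+p\sigma_1^6+3(1+p)\sigma_0^2\sigma_1^4+3(2-p)\sigma_0^4\sigma_1^2+\overline p\sigma_0^6,\\ r_4&=2p\overline p(\sigma_1^2+\sigma_0^2)\|\mu_1-\mu_0\|^2+(2p+1)\sigma_1^4+(3-2p)\sigma_0^4+6\sigma_0^2\sigma_1^2,\\ r_5&=p\overline p\|\mu_1-\mu_0\|^2+(3-p)\sigma_0^2+(2+p)\sigma_1^2. \end{aligned}$$ Additionally, $$\epsilon_A^{\mathrm{CCG}}=\frac{c_1d^2+c_2d+c_3}{c_4},$$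 where $$\begin{aligned} c_1&=p\overline p(\sigma_1^2-\sigma_0^2)^4(\sigma^2+p\sigma_1^2+\overline p\sigma_0^2),\\ c_2&=2(\sigma_1^2-\sigma_0^2)^2\Big((\sigma_0^2+\sigma^2)^3+p(1-p)\|\mu_1-\mu_0\|^2(\sigma_0^2+\sigma^2)(\sigma_1^2+\sigma^2)\\ &\quad+p^2(\sigma_1^2-\sigma_0^2)^2(\sigma_1^2+\sigma_0^2+2\sigma^2)+p(\sigma_0^2+\sigma^2)(\sigma_1^2-\sigma_0^2)(\sigma_1^2+2\sigma_0^2+3\sigma^2)\Big),\\ c_3&=p\overline p\|\mu_1-\mu_0\|^2(\sigma_1^2-\sigma_0^2)^2\Big(4(\sigma_0^2+\sigma^2)(\sigma_1^2+\sigma^2)+\|\mu_1-\mu_0\|^2(p\sigma_1^2+\overline p\sigma_0^2+\sigma^2)\Big),\\ c_4&=16(r_1+r_2\sigma^2+r_3\sigma^4+r_4\sigma^6+r_5\sigma^8+\sigma^{10}). \end{aligned}$$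
   Context: $s(z)=1/(1+e^{-z})$ is the sigmoid function. $\eta^\sigma(x)=\mathbb E[S\vert X^\sigma=x]$. $h^*_{\mathcal H}\in\arg\min_{h\in\mathcal H}\mathbb E[(S-h(X^\sigma))^2]$ denotes a minimizer over $\mathcal H$ (the minimum is assumed attained), and $\epsilon_A:=\mathbb E[(\eta^\sigma(X^\sigma)-h^*_{\mathcal H}(X^\sigma))^2]$. Definition of $\epsilon_A^{\mathrm{CCG}}$: put $\Sigma_k=\sigma_k^2I$, $\tilde\Sigma_k=\Sigma_k+\sigma^2I$, $\mu_d=\mu_1-\mu_0$ (the subscript is a label, unrelated to the dimension), $A=\frac12(\tilde\Sigma_0^{-1}-\tilde\Sigma_1^{-1})$, $b=\tilde\Sigma_1^{-1}\mu_1-\tilde\Sigma_0^{-1}\mu_0$, $c=\frac12\mu_0^{\mathrm T}\tilde\Sigma_0^{-1}\mu_0-\frac12\mu_1^{\mathrm T}\tilde\Sigma_1^{-1}\mu_1+\frac12\log(|\tilde\Sigma_0|/|\tilde\Sigma_1|)+\log(p/\overline p)$ ($|\cdot|$ is the determinant). For $k\in\{0,1\}$ let $\lambda_j^{(k)}$ be the eigenvalues of $\tilde\Sigma_k^{1/2}A\tilde\Sigma_k^{1/2}$, $Q_k$ an orthogonal matrix whose columns are corresponding eigenvectors, $u^{(k)}=Q_k^{\mathrm T}\tilde\Sigma_k^{1/2}(b+2A\mu_k)$, $M_k=\sum_{j=1}^d\lambda_j^{(k)}+b^{\mathrm T}\mu_k+\mu_k^{\mathrm T}A\mu_k+c$,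 $V_k=\sum_{j=1}^d\big(2(\lambda_j^{(k)})^2+(u_j^{(k)})^2\big)$. Then $$\epsilon_A^{\mathrm{CCG}}:=\tfrac14\big(\mathrm{VAR}_1-\mathrm{COV}\,\mathrm{VAR}_2^{-1}\,\mathrm{COV}^{\mathrm T}\big),$$ with $\mathrm{VAR}_1=pV_1+\overline pV_0+p\overline p(M_1-M_0)^2$, $\mathrm{VAR}_2=p\Sigma_1+\overline p\Sigma_0+p\overline p\mu_d\mu_d^{\mathrm T}+\sigma^2I$, and the row vector $\mathrm{COV}=2p\mu_1^{\mathrm T}A\Sigma_1+2\overline p\mu_0^{\mathrm T}A\Sigma_0+2\sigma^2[p\mu_1+\overline p\mu_0]^{\mathrm T}A+p\overline p[\mathrm{tr}(A(\Sigma_1-\Sigma_0))+\mu_1^{\mathrm T}A\mu_1-\mu_0^{\mathrm T}A\mu_0]\mu_d^{\mathrm T}+b^{\mathrm T}[p\Sigma_1+\overline p\Sigma_0+\sigma^2I+p\overline p\mu_d\mu_d^{\mathrm T}]$. *)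

(* Defs.v *)
From HB Require Import structures.
From mathcomp Require Import all_boot all_order all_algebra.
From mathcomp Require Import all_classical all_reals all_analysis.

Set Implicit Arguments.
Unset Strict Implicit.
Unset Printing Implicit Defensive.

Import Order.TTheory GRing.Theory Num.Theory.
Import numFieldNormedType.Exports.

Local Open Scope classical_set_scope.
Local Open Scope ring_scope.

(* The sigma-algebra on matrices generated by the entries; on ['cV[R]_d] this
   is the Borel sigma-algebra of R^d. *)
Definition measure_matrix_display : measure_display -> measure_display.
Proof. exact. Qed.

Section measurable_matrix.
Context {disp : measure_display} {T : measurableType disp} (m n : nat).

Definition g_sigma_entries : set (set 'M[T]_(m, n)) :=
  <<s [set B | exists i j (C : set T),
        measurable C /\ B = [set M : 'M[T]_(m, n) | C (M i j)]] >>.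

Let entries_set0 : g_sigma_entries set0.
Proof. exact: sigma_algebra0. Qed.

Let entries_setC A : g_sigma_entries A -> g_sigma_entries (~` A).
Proof. exact: sigma_algebraC. Qed.

Let entries_bigcup (F : (set 'M[T]_(m, n))^nat) :
  (forall i, g_sigma_entries (F i)) -> g_sigma_entries (\bigcup_i F i).
Proof. exact: sigma_algebra_bigcup. Qed.

HB.instance Definition _ := @isMeasurable.Build (measure_matrix_display disp)
  'M[T]_(m, n) g_sigma_entries entries_set0 entries_setC entries_bigcup.

End measurable_matrix.

Section euclidean.
Context {R : realType}.

(* The library norm [`|v|] on ['cV[R]_d] is the sup norm. *)
Definition enorm (d : nat) (v : 'cV[R]_d) : R :=
  Num.sqrt (\sum_(i < d) v i 0 ^+ 2).

(* A 1 x 1 matrix read as a scalar. *)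
Definition scal (M : 'M[R]_1) : R := M 0 0.

(* T = B^(1/2): the symmetric positive semidefinite square root. *)
Definition is_psd_sqrt (d : nat) (B T : 'M[R]_d) : Prop :=
  [/\ T^T = T, forall x : 'cV[R]_d, 0 <= scal (x^T *m T *m x) & T *m T = B].

(* Q is orthogonal and its columns are eigenvectors of B, the j-th one for the
   eigenvalue [lam 0 j]; so [lam] lists the eigenvalues with multiplicity. *)
Definition is_eigendecomposition (d : nat) (B Q : 'M[R]_d) (lam : 'rV[R]_d)
    : Prop :=
  Q^T *m Q = 1%:M /\ B *m Q = Q *m diag_mx lam.

End euclidean.

Section probability.
Context {R : realType}.

(* The d-dimensional Lebesgue integral, written as an iterated integral; used
   only for nonnegative measurable integrands, for which the two agree. *)
Fixpoint lebesgue_integral_cV (d : nat) : ('cV[R]_d -> \bar R) -> \bar R :=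
  match d with
  | 0%N => fun f => f 0
  | d'.+1 => fun f =>
      (\int[lebesgue_measure]_(x in [set: R])
         lebesgue_integral_cV (fun v : 'cV[R]_d' =>
           f (col_mx (const_mx x : 'cV[R]_1) v)))%E
  end.

Definition mvnormal_pdf (d : nat) (m : 'cV[R]_d) (V : 'M[R]_d) (x : 'cV[R]_d)
    : R :=
  (Num.sqrt ((2 * pi) ^+ d * \det V))^-1
  * expR (- 2^-1 * scal ((x - m)^T *m invmx V *m (x - m))).

(* The normal law N(m, V) on R^d, for V symmetric positive definite. *)
Definition mvnormal (d : nat) (m : 'cV[R]_d) (V : 'M[R]_d)
    (B : set 'cV[R]_d) : \bar R :=
  lebesgue_integral_cV (fun x => (\1_B x * mvnormal_pdf m V x)%:E).

Context {disp : measure_display} {Omega : measurableType disp}.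
Variable P : probability Omega R.

Definition cond_prob (A E : set Omega) : R :=
  fine (P (A `&` E)) / fine (P E).

Definition independent {d1 d2 : measure_display} {T1 : measurableType d1}
    {T2 : measurableType d2} (X1 : Omega -> T1) (X2 : Omega -> T2) : Prop :=
  forall (B1 : set T1) (B2 : set T2), measurable B1 -> measurable B2 ->
    P (X1 @^-1` B1 `&` X2 @^-1` B2) = (P (X1 @^-1` B1) * P (X2 @^-1` B2))%E.

(* [eta] is (a version of) x |-> E[Y | X = x]. *)
Definition is_regression_function {d1 : measure_display}
    {T1 : measurableType d1} (Y : Omega -> R) (X : Omega -> T1)
    (eta : T1 -> R) : Prop :=
  [/\ measurable_fun [set: T1] eta,
      P.-integrable [set: Omega] (fun w => (eta (X w))%:E) &
      forall B : set T1, measurable B ->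
        (\int[P]_(w in X @^-1` B) (eta (X w))%:E
         = \int[P]_(w in X @^-1` B) (Y w)%:E)%E].

Definition is_mse_minimizer {T1 : Type} (Y : Omega -> R) (X : Omega -> T1)
    (H : set (T1 -> R)) (h : T1 -> R) : Prop :=
  H h /\ forall g, H g ->
    ('E_P[fun w => ((Y w - h (X w)) ^+ 2)%R]
     <= 'E_P[fun w => ((Y w - g (X w)) ^+ 2)%R])%E.

Definition approximation_error {T1 : Type} (X : Omega -> T1)
    (eta h : T1 -> R) : \bar R :=
  'E_P[fun w => ((eta (X w) - h (X w)) ^+ 2)%R]%E.

Definition noisy (d : nat) (sigma : R) (X Z : Omega -> 'cV[R]_d)
    : Omega -> 'cV[R]_d :=
  fun w => X w + sigma *: Z w.

End probability.

Definition sigmoid {R : realType} (z : R) : R := (1 + expR (- z))^-1.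

Definition logistic_class {R : realType} (d : nat) : set ('cV[R]_d -> R) :=
  [set h | exists (a : 'cV[R]_d) (b : R),
     h = fun x => sigmoid (scal (a^T *m x) + b)].

Arguments logistic_class {R} d _.

(* Throughout, [true] and [false] stand for the class labels 1 and 0. *)
Section ccg.
Context {R : realType} (d : nat) (p : R).
Context (mu : bool -> 'cV[R]_d) (sg : bool -> R) (sigma : R).

Local Notation pbar := (1 - p).
Local Notation mu0 := (mu false).
Local Notation mu1 := (mu true).

Definition Sig (k : bool) : 'M[R]_d := (sg k ^+ 2)%:M.
Definition tSig (k : bool) : 'M[R]_d := Sig k + (sigma ^+ 2)%:M.
Definition mud : 'cV[R]_d := mu1 - mu0.

(* The posterior log-odds of label 1 given X + sigma Z = x is
   x^T A x + b^T x + c. *)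
Definition ccgA : 'M[R]_d := 2^-1 *: (invmx (tSig false) - invmx (tSig true)).

Definition ccgb : 'cV[R]_d :=
  invmx (tSig true) *m mu1 - invmx (tSig false) *m mu0.

Definition ccgc : R :=
  2^-1 * scal (mu0^T *m invmx (tSig false) *m mu0)
  - 2^-1 * scal (mu1^T *m invmx (tSig true) *m mu1)
  + 2^-1 * ln (\det (tSig false) / \det (tSig true))
  + ln (p / pbar).

Definition ccgVAR2 : 'M[R]_d :=
  p *: Sig true + pbar *: Sig false + (p * pbar) *: (mud *m mud^T)
  + (sigma ^+ 2)%:M.

Definition ccgCOV : 'rV[R]_d :=
  (2 * p) *: (mu1^T *m ccgA *m Sig true)
  + (2 * pbar) *: (mu0^T *m ccgA *m Sig false)
  + (2 * sigma ^+ 2) *: ((p *: mu1 + pbar *: mu0)^T *m ccgA)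
  + (p * pbar * (\tr (ccgA *m (Sig true - Sig false))
       + scal (mu1^T *m ccgA *m mu1) - scal (mu0^T *m ccgA *m mu0)))
    *: mud^T
  + ccgb^T *m (p *: Sig true + pbar *: Sig false + (sigma ^+ 2)%:M
               + (p * pbar) *: (mud *m mud^T)).

(* T k = tSig k ^(1/2), and (Q k, lam k) diagonalizes T k *m A *m T k. *)
Definition is_ccg_spectral_data (T Q : bool -> 'M[R]_d)
    (lam : bool -> 'rV[R]_d) : Prop :=
  forall k, is_psd_sqrt (tSig k) (T k) /\
            is_eigendecomposition (T k *m ccgA *m T k) (Q k) (lam k).

Section spectral.
Context (T Q : bool -> 'M[R]_d) (lam : bool -> 'rV[R]_d).

Definition ccgu (k : bool) : 'cV[R]_d :=
  (Q k)^T *m T k *m (ccgb + 2 *: (ccgA *m mu k)).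

Definition ccgM (k : bool) : R :=
  \sum_(j < d) lam k 0 j + scal (ccgb^T *m mu k)
  + scal ((mu k)^T *m ccgA *m mu k) + ccgc.

Definition ccgV (k : bool) : R :=
  \sum_(j < d) (2 * lam k 0 j ^+ 2 + ccgu k j 0 ^+ 2).

Definition ccgVAR1 : R :=
  p * ccgV true + pbar * ccgV false
  + p * pbar * (ccgM true - ccgM false) ^+ 2.

Definition eps_CCG : R :=
  4^-1 * (ccgVAR1 - scal (ccgCOV *m invmx ccgVAR2 *m ccgCOV^T)).

End spectral.
End ccg.

(* The coefficients of the closed forms: [n] is the Euclidean norm of the
   difference of the means, [s0], [s1] the class standard deviations and [s] the
   noise level. *)
Section coefficients.
Context {R : realType} (d : nat) (p n s0 s1 s : R).

Local Notation pbar := (1 - p).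
Local Notation D := (d%:R : R).

Definition q1 : R :=
  n ^+ 4 * (p ^+ 2 * pbar * s1 ^+ 2 + p * pbar ^+ 2 * s0 ^+ 2)
  + 2 * D * s0 ^+ 6
  - D ^+ 2 * p ^+ 3 * (s1 ^+ 2 - s0 ^+ 2) ^+ 3
  + 2 * p * pbar * (2 + D) * s0 ^+ 2 * s1 ^+ 2 * n ^+ 2
  + p ^+ 2 * (D * (5 * D - 2) * s0 ^+ 4 * s1 ^+ 2
              - 2 * D * (2 * D + 1) * s0 ^+ 2 * s1 ^+ 4
              + D * (2 + D) * s1 ^+ 6
              - 2 * D * (D - 1) * s0 ^+ 6)
  + p * (D * (D - 4) * s0 ^+ 6
         - 2 * D * (D - 1) * s0 ^+ 4 * s1 ^+ 2
         + D * (2 + D) * s0 ^+ 2 * s1 ^+ 4).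

Definition q2 : R :=
  p * pbar * n ^+ 2 * (n ^+ 2 + 2 * (2 + D) * (s0 ^+ 2 + s1 ^+ 2))
  - p ^+ 2 * D * (D - 4) * (s1 ^+ 2 - s0 ^+ 2) ^+ 2
  + p * (D * (D - 10) * s0 ^+ 4
         - 2 * D * (D - 4) * s0 ^+ 2 * s1 ^+ 2
         + D * (2 + D) * s1 ^+ 4)
  + 6 * D * s0 ^+ 4.

Definition q3 : R :=
  2 * p * pbar * (2 + D) * n ^+ 2
  + 6 * D * (p * s1 ^+ 2 + pbar * s0 ^+ 2).

Definition r1 : R :=
  s0 ^+ 4 * s1 ^+ 4 * (p * pbar * n ^+ 2 + p * s1 ^+ 2 + pbar * s0 ^+ 2).

Definition r2 : R :=
  s0 ^+ 2 * s1 ^+ 2 *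
  (2 * p * pbar * (s1 ^+ 2 + s0 ^+ 2) * n ^+ 2
   + 2 * p * s1 ^+ 4 + 2 * pbar * s0 ^+ 4 + 3 * s0 ^+ 2 * s1 ^+ 2).

Definition r3 : R :=
  p * pbar * (s0 ^+ 4 + 4 * s0 ^+ 2 * s1 ^+ 2 + s1 ^+ 4) * n ^+ 2
  + p * s1 ^+ 6
  + 3 * (1 + p) * s0 ^+ 2 * s1 ^+ 4
  + 3 * (2 - p) * s0 ^+ 4 * s1 ^+ 2
  + pbar * s0 ^+ 6.

Definition r4 : R :=
  2 * p * pbar * (s1 ^+ 2 + s0 ^+ 2) * n ^+ 2
  + (2 * p + 1) * s1 ^+ 4
  + (3 - 2 * p) * s0 ^+ 4
  + 6 * s0 ^+ 2 * s1 ^+ 2.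

Definition r5 : R :=
  p * pbar * n ^+ 2 + (3 - p) * s0 ^+ 2 + (2 + p) * s1 ^+ 2.

Definition c1 : R :=
  p * pbar * (s1 ^+ 2 - s0 ^+ 2) ^+ 4
  * (s ^+ 2 + p * s1 ^+ 2 + pbar * s0 ^+ 2).

Definition c2 : R :=
  2 * (s1 ^+ 2 - s0 ^+ 2) ^+ 2 *
  ((s0 ^+ 2 + s ^+ 2) ^+ 3
   + p * (1 - p) * n ^+ 2 * (s0 ^+ 2 + s ^+ 2) * (s1 ^+ 2 + s ^+ 2)
   + p ^+ 2 * (s1 ^+ 2 - s0 ^+ 2) ^+ 2 * (s1 ^+ 2 + s0 ^+ 2 + 2 * s ^+ 2)
   + p * (s0 ^+ 2 + s ^+ 2) * (s1 ^+ 2 - s0 ^+ 2)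
     * (s1 ^+ 2 + 2 * s0 ^+ 2 + 3 * s ^+ 2)).

Definition c3 : R :=
  p * pbar * n ^+ 2 * (s1 ^+ 2 - s0 ^+ 2) ^+ 2 *
  (4 * (s0 ^+ 2 + s ^+ 2) * (s1 ^+ 2 + s ^+ 2)
   + n ^+ 2 * (p * s1 ^+ 2 + pbar * s0 ^+ 2 + s ^+ 2)).

Definition c4 : R :=
  16 * (r1 + r2 * s ^+ 2 + r3 * s ^+ 4 + r4 * s ^+ 6 + r5 * s ^+ 8
        + s ^+ 10).

End coefficients.

(* Main.v *)
Require Import Defs.
(* Given S = k, the noisy input is N(mu_k, t_k I) with t_k = sg_k^2 + sigma^2, so
   the posterior probability of label 1 is the sigmoid of the log-odds L, and the
   regression function is almost surely sigmoid(L).  The mean squared error of h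
   splits as E(sigmoid(L) - h)^2 plus a constant; hence the minimizer beats any
   logistic function with affine logit l, and, the sigmoid being 1/2-Lipschitz,
   eps_A <= 1/4 E(L - l)^2.  L - l is a quadratic polynomial in x whose second
   moments under the two Gaussians are explicit.  On the algebraic side ccgA is
   scalar and ccgVAR2 is scalar plus a multiple of mud mud^T, so mud is an
   eigenvector of ccgVAR2, with eigenvalue w, and ccgCOV = kappa mud^T.  The
   affine function of slope (kappa / w) mud, suitably centred, attains
   1/4 E(L - l)^2 = eps_CCG; the closed forms are then field identities. *)
From HB Require Import structures.
From mathcomp Require Import all_boot all_order all_algebra.
From mathcomp Require Import all_classical all_reals all_analysis.
From mathcomp Require Import measurable_realfun ring lra.

Set Implicit Arguments.
Unset Strict Implicit.
Unset Printing Implicit Defensive.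

Import Order.TTheory GRing.Theory Num.Theory.
Import numFieldNormedType.Exports.

Local Open Scope classical_set_scope.
Local Open Scope ring_scope.

(** * One-dimensional normal laws *)

(** [eps_CCG] is a quarter of the residual variance in the linear regression of L on the noisy
    input: [ccgVAR1], [ccgCOV] and [ccgVAR2] are formulas for the variance of L, its covariance with
    the input, and the input's covariance matrix. They are not derived as moments here. An upper
    bound needs only one affine competitor, and its slope can be sought along mud, the only
    direction singled out by two isotropic classes. The mean square gap then depends on a single
    real [om] and is computed directly, so that the probabilistic and the matrix sides meet only in
    a rational identity in p, t_0, t_1, d and the squared norm of mud. The regression function is
    known only through integrals over preimages of measurable sets; it is therefore compared with
    sigmoid(L) almost everywhere for the law of the noisy input. Integrands are kept nonnegative
    wherever possible, so that Tonelli exchanges ask for no integrability; the one-dimensional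
    second moment is the main exception. *)

Lemma ge0_integral_pushforwardT d1 d2 (T1 : measurableType d1) (T2 : measurableType d2)
    (R : realType) (phi : T1 -> T2) (mphi : measurable_fun [set: T1] phi)
    (m : {measure set T1 -> \bar R}) (f : T2 -> \bar R) :
  measurable_fun [set: T2] f -> (forall y, 0 <= f y)%E ->
  (\int[pushforward m phi]_y f y = \int[m]_x f (phi x))%E.
Proof.
move=> mf f0.
by rewrite (ge0_integral_pushforward mphi m measurableT mf) ?preimage_setT.
Qed.

(** * Translation invariance and integration against a normal density *)

Section lebesgue_translation.
Local Open Scope ereal_scope.
Context {R : realType}.
Local Notation mu := (@lebesgue_measure R).

(** Lebesgue measure is determined by half-open intervals, whose lengths a translation preserves. *)
Lemma lebesgue_measureD (c : R) (A : set R) : measurable A ->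
  pushforward mu (fun x : R => (x + c)%R : measurableTypeR R) A = mu A.
Proof.
move=> mA.
have mc : measurable_fun [set: R] (fun x : R => (x + c)%R : measurableTypeR R).
  exact: measurable_funD.
apply/esym/lebesgue_measure_unique => //= _ [[a b]] _ <-.
rewrite /pushforward.
have -> : (fun x : R => (x + c)%R) @^-1` `]a, b] = `](a - c)%R, (b - c)%R]%classic.
  by apply/seteqP; split=> x /=; rewrite !in_itv/= ltrBlDr lerBrDr.
rewrite !lebesgue_measure_itv/= !lte_fin ltrD2r.
by case: ifP => // _; rewrite -!EFinB; congr (_%:E); ring.
Qed.

Lemma ge0_integral_translation (c : R) (f : R -> \bar R) :
  measurable_fun [set: R] f -> (forall x, 0 <= f x) ->
  \int[mu]_x f (x + c)%R = \int[mu]_x f x.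
Proof.
move=> mf f0.
have mc : measurable_fun [set: R] (fun x : R => (x + c)%R : measurableTypeR R).
  exact: measurable_funD.
transitivity (\int[pushforward mu (fun x : R => (x + c)%R : measurableTypeR R)]_x f x).
  by rewrite ge0_integral_pushforward// preimage_setT.
by apply: eq_measure_integral => A mA _; exact: lebesgue_measureD.
Qed.

(** Change of variables holds for the Radon-Nikodym derivative, which equals [normal_pdf] almost
    everywhere because both integrate to the same value on every measurable set. *)
Lemma ge0_integral_normal_prob (m s : R) (f : R -> \bar R) :
  measurable_fun [set: R] f -> (forall x, 0 <= f x) ->
  \int[normal_prob m s]_x f x = \int[mu]_x (f x * (normal_pdf m s x)%:E).
Proof.
move=> mf f0.
have dom := @normal_prob_dominates R m s.
rewrite -(Radon_Nikodym_SigmaFinite.change_of_variables dom)//.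
have mpdf : measurable_fun [set: R] (fun x => (normal_pdf m s x)%:E).
  by apply/measurable_EFinP; exact: measurable_normal_pdf.
have mRN : measurable_fun [set: R]
    (Radon_Nikodym_SigmaFinite.f (normal_prob m s) mu).
  exact: (measurable_int mu (Radon_Nikodym_SigmaFinite.f_integrable dom)).
apply: ge0_ae_eq_integral => //.
- exact: emeasurable_funM.
- exact: emeasurable_funM.
- by move=> x _; rewrite mule_ge0// Radon_Nikodym_SigmaFinite.f_ge0.
- by move=> x _; rewrite mule_ge0// lee_fin normal_pdf_ge0.
have : ae_eq mu setT (Radon_Nikodym_SigmaFinite.f (normal_prob m s) mu)
    (fun x => (normal_pdf m s x)%:E).
  apply: integral_ae_eq => //.
  - exact: Radon_Nikodym_SigmaFinite.f_integrable.
  - by move=> A _ mA; rewrite -Radon_Nikodym_SigmaFinite.f_integral.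
by apply: filterS => x /= /[apply] ->.
Qed.

End lebesgue_translation.

(** * Convolution of one-dimensional normal laws *)

Section normal_convolution.
Context {R : realType}.

Lemma normal_peak_sqr (s : R) : normal_peak s ^+ 2 = (s ^+ 2 * pi *+ 2)^-1.
Proof.
rewrite /normal_peak exprVn sqr_sqrtr// mulrn_wge0//.
by rewrite mulr_ge0 ?sqr_ge0 ?pi_ge0.
Qed.

(* Completing the square in z. *)
Lemma normal_pdf_conv (m s sigma t x z : R) :
  s != 0 -> sigma != 0 -> t != 0 -> s ^+ 2 + sigma ^+ 2 = t ^+ 2 ->
  normal_pdf m s (x - sigma * z) * normal_pdf 0 1 z =
  normal_pdf m t x * normal_pdf (sigma * (x - m) / t ^+ 2) (s / t) z.
Proof.
move=> s0 g0 t0 st.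
rewrite !normal_pdfE ?oner_eq0 ?mulf_neq0 ?invr_eq0//.
rewrite mulrACA [RHS]mulrACA; congr (_ * _).
  (* The peaks are inverse square roots, so they are compared through their squares. *)
  apply: (@pexpIrn _ 2) => //; rewrite ?nnegrE ?mulr_ge0 ?normal_peak_ge0//.
  rewrite !exprMn !normal_peak_sqr -!invfM; congr (_^-1).
  by field.
rewrite /normal_fun -!expRD; congr expR.
rewrite expr_div_n -st; field.
by rewrite st !expf_neq0.
Qed.

(** With z outermost, translating x by sigma z moves the shift from f into the density. After
    exchanging back, [normal_pdf_conv] splits the two densities into the N(m, t^2) density at x and
    a normal density in z, whose integral is 1. *)
Lemma ge0_normal_prob_conv (m s sigma t : R) (f : R -> \bar R) :
  s != 0 -> sigma != 0 -> t != 0 -> s ^+ 2 + sigma ^+ 2 = t ^+ 2 ->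
  measurable_fun [set: R] f -> (forall x, 0 <= f x)%E ->
  (\int[normal_prob m s]_x \int[normal_prob 0 1]_z f (x + sigma * z)%R
   = \int[normal_prob m t]_x f x)%E.
Proof.
move=> s0 g0 t0 st mf f0.
pose g (xz : R * R) := f (xz.1 + sigma * xz.2).
have mg : measurable_fun [set: R * R] g.
  apply: measurableT_comp => //; apply: measurable_funD => //.
  exact: measurable_funM.
have -> : (\int[normal_prob m s]_x \int[normal_prob 0 1]_z f (x + sigma * z)%R =
    \int[normal_prob 0 1]_z \int[normal_prob m s]_x f (x + sigma * z)%R)%E.
  exact: (@fubini_tonelli _ _ _ _ _ (normal_prob m s) (normal_prob 0 1) g mg (fun xz => f0 _)).
have mx z : measurable_fun [set: R] (fun x => f (x + sigma * z)).
  by apply: measurableT_comp => //; exact: measurable_funD.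
have mpdf u v : measurable_fun [set: R] (fun x : R => (normal_pdf u v x)%:E).
  by apply/measurable_EFinP; exact: measurable_normal_pdf.
have inner z : (\int[normal_prob m s]_x f (x + sigma * z)%R =
    \int[lebesgue_measure]_x (f x * (normal_pdf m s (x - sigma * z))%:E))%E.
  rewrite (ge0_integral_normal_prob m s (mx z) (fun x => f0 _)).
  rewrite -[RHS](@ge0_integral_translation _ (sigma * z)); last 2 first.
  - apply: emeasurable_funM => //; apply/measurable_EFinP.
    apply: (measurableT_comp (measurable_normal_pdf m s)).
    exact: measurable_funB.
  - by move=> x; rewrite mule_ge0// lee_fin normal_pdf_ge0.
  by apply: eq_integral => x _; rewrite addrK.
under eq_integral do rewrite inner.
pose h (xz : R * R) :=
  (f xz.1 * (normal_pdf m s (xz.1 - sigma * xz.2))%:E * (normal_pdf 0 1 xz.2)%:E)%E.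
have mh : measurable_fun [set: R * R] h.
  apply: emeasurable_funM; first apply: emeasurable_funM.
  - exact: measurableT_comp.
  - apply/measurable_EFinP; apply: (measurableT_comp (measurable_normal_pdf m s)).
    by apply: measurable_funB => //; exact: measurable_funM.
  - by apply/measurable_EFinP; apply: (measurableT_comp (measurable_normal_pdf 0 1)).
have h0 xz : (0 <= h xz)%E by rewrite !mule_ge0 ?lee_fin ?normal_pdf_ge0.
transitivity (\int[lebesgue_measure]_z \int[lebesgue_measure]_x h (x, z))%E.
  pose h1 (xz : R * R) := (f xz.1 * (normal_pdf m s (xz.1 - sigma * xz.2))%:E)%E.
  have mh1 : measurable_fun [set: R * R] h1.
    apply: emeasurable_funM; first exact: measurableT_comp.
    apply/measurable_EFinP; apply: (measurableT_comp (measurable_normal_pdf m s)).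
    by apply: measurable_funB => //; exact: measurable_funM.
  have h10 xz : (0 <= h1 xz)%E by rewrite mule_ge0// lee_fin normal_pdf_ge0.
  transitivity (\int[lebesgue_measure]_z
      (fubini_G lebesgue_measure h1 z * (normal_pdf 0 1 z)%:E))%E.
    apply: (@ge0_integral_normal_prob R 0 1 (fubini_G lebesgue_measure h1)).
      exact: (@measurable_fun_fubini_tonelli_G _ _ _ _ _ lebesgue_measure h1 mh1 h10).
    by move=> z; apply: integral_ge0 => x _.
  apply: eq_integral => z _; rewrite /h/= ge0_integralZr//.
  - apply: emeasurable_funM => //; apply/measurable_EFinP.
    by apply: (measurableT_comp (measurable_normal_pdf m s)); exact: measurable_funB.
  - by move=> x _; rewrite mule_ge0// lee_fin normal_pdf_ge0.
  - by rewrite lee_fin normal_pdf_ge0.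
rewrite -(@fubini_tonelli _ _ _ _ _ lebesgue_measure lebesgue_measure h mh h0).
rewrite (ge0_integral_normal_prob m t mf f0); apply: eq_integral => x _.
rewrite /h/=.
under eq_integral do rewrite -muleA -EFinM (normal_pdf_conv _ _ _ s0 g0 t0 st) EFinM muleA.
rewrite ge0_integralZl//; last 3 first.
- exact: mpdf.
- by move=> z _; rewrite lee_fin normal_pdf_ge0.
- by rewrite mule_ge0// lee_fin normal_pdf_ge0.
by rewrite integral_normal_pdf mule1.
Qed.

End normal_convolution.

(** * Second moment of a quadratic polynomial under a normal law *)

Section normal_moment.
Context {R : realType}.
Local Notation mu := (@lebesgue_measure R).

(** The fundamental theorem of calculus on growing intervals centred at m, passed to the limit by
    dominated convergence with majorant |f|. *)
Lemma integral_derivative_eq0 (m : R) (f F : R -> R) :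
  continuous f -> mu.-integrable [set: R] (EFin \o f) ->
  (forall x : R, is_derive x 1 F (f x)) ->
  (F (m + n.+1%:R) @[n --> \oo] --> 0) ->
  (F (m - n.+1%:R) @[n --> \oo] --> 0) ->
  (\int[mu]_x (f x)%:E = 0)%E.
Proof.
move=> cf intf dF Fp Fn.
(* The successor keeps every interval, including the one for n = 0, nondegenerate. *)
pose I n := `[m - n.+1%:R, m + n.+1%:R]%classic : set R.
have lt_I n : m - n.+1%:R < m + n.+1%:R :> R.
  by rewrite ltrD2l gtrN// ltr0n.
have IE n : (\int[mu]_(x in I n) (f x)%:E = (F (m + n.+1%:R) - F (m - n.+1%:R))%:E)%E.
  rewrite /I (@continuous_FTC2 _ f F)//.
  - by apply: continuous_subspaceT.
  - have cF : continuous F.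
      move=> x; apply: differentiable_continuous; apply/derivable1_diffP.
      by have [] := dF x.
    split.
    + by move=> x _; have [] := dF x.
    + by apply: cvg_at_right_filter; exact: cF.
    + by apply: cvg_at_left_filter; exact: cF.
  - by move=> x _; rewrite derive1E; have [] := dF x.
have mf : measurable_fun [set: R] f by exact: continuous_measurable_fun.
pose g n x := ((f \_ (I n)) x)%:E.
have /= [] := @dominated_convergence _ _ _ mu setT measurableT g
  (EFin \o f) (fun x => `|(f x)%:E|%E).
- move=> n; apply/measurable_EFinP.
  have mIn : measurable (I n : set (measurableTypeR R)) by exact: measurable_itv.
  have mfI : measurable_fun (I n : set (measurableTypeR R)) (f : measurableTypeR R -> R).
    exact: measurable_funTS.
  exact: (iffLR (measurable_restrictT f mIn) mfI).
- by apply/measurable_EFinP; exact: mf.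
- apply/aeW => x _; apply: cvg_near_cst; near=> n.
  rewrite /g patchE ifT// inE /I/= in_itv/=.
  rewrite -ler_distlC; apply: (@le_trans _ _ n%:R); last by rewrite ler_nat.
  by near: n; exact: nbhs_infty_ger.
- exact: (integrable_abse intf).
- apply/aeW => x n _; rewrite lee_fin patchE; case: ifPn => // _.
  by rewrite normr0.
move=> _ _ cvgI.
apply: (cvg_unique _ cvgI); first exact: ereal_hausdorff.
rewrite (_ : (fun n => _) = (fun n => (F (m + n.+1%:R) - F (m - n.+1%:R))%:E)); last first.
  apply/funext => n; rewrite -IE [RHS]integral_mkcond.
  by apply: eq_integral => x _; rewrite /g restrict_EFin.
apply: cvg_EFin; first by near=> n.
rewrite -[0]subr0; exact: cvgB.
Unshelve. all: by end_near. Qed.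

Lemma sqr_expRN_le (u : R) : 0 <= u -> u ^+ 2 * expR (- u) <= 2.
Proof.
move=> u0; rewrite expRN ler_pdivrMr ?expR_gt0//.
have := expR_ge1Dxn 1 u0; rewrite (_ : 2`!%:R = 2 :> R)//.
by lra.
Qed.

Lemma is_derive_normal_pdf (m s x : R) : s != 0 ->
  is_derive x 1 (normal_pdf m s) (- (x - m) / s ^+ 2 * normal_pdf m s x).
Proof.
move=> s0; rewrite normal_pdfE// /normal_fun.
have d1 : is_derive x 1 (fun y : R => y - m) 1 by apply: is_derive_eq; rewrite subr0.
have d2 : is_derive x 1 (fun y : R => - (y - m) ^+ 2 / (s ^+ 2 *+ 2)) (- (x - m) / s ^+ 2).
  apply: is_derive_eq.
  rewrite /GRing.scale/= !mulr0 !add0r.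
  by field.
have d3 := @is_derive1_comp _ _ _ _ _ _ (is_derive_expR _) d2.
apply: is_derive_eq.
rewrite /GRing.scale/=.
by ring.
Qed.

Lemma is_derive_cubic_normal_pdf (m s q0 q1 q2 q3 x : R) : s != 0 ->
  is_derive x 1 (fun x : R =>
     (q0 + q1 * (x - m) + q2 * (x - m) ^+ 2 + q3 * (x - m) ^+ 3) * normal_pdf m s x)
   ((q1 + 2 * q2 * (x - m) + 3 * q3 * (x - m) ^+ 2
    - (q0 + q1 * (x - m) + q2 * (x - m) ^+ 2 + q3 * (x - m) ^+ 3) * (x - m) / s ^+ 2)
   * normal_pdf m s x).
Proof.
move=> s0; have dn := is_derive_normal_pdf m x s0.
have d1 : is_derive x 1 (fun y : R => y - m) 1 by apply: is_derive_eq; rewrite subr0.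
apply: is_derive_eq.
rewrite /GRing.scale/=.
by field.
Qed.

(** Trading y^4 for a doubled variance yields both an integrable majorant and decay at infinity. The
    constant is 16 * 2, with 2 from [sqr_expRN_le], times the ratio sqrt 2 of the two peaks. *)
Lemma normal_pdf_expR4 (m s y : R) : s != 0 ->
  y ^+ 4 * normal_pdf m s (m + y) <=
  32 * Num.sqrt 2 * s ^+ 4 * normal_pdf m (Num.sqrt 2 * s) (m + y).
Proof.
move=> s0.
have s20 : Num.sqrt 2 * s != 0 by rewrite mulf_neq0// gt_eqF// sqrtr_gt0.
rewrite !normal_pdfE//.
have -> : normal_peak (Num.sqrt 2 * s) = normal_peak s / Num.sqrt 2 :> R.
  rewrite /normal_peak exprMn sqr_sqrtr// -invfM -sqrtrM; last first.
    by rewrite mulrn_wge0// mulr_ge0 ?sqr_ge0 ?pi_ge0.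
  by congr (Num.sqrt _)^-1; ring.
rewrite /normal_fun (addrC m) addrK exprMn sqr_sqrtr//.
(* The exponent is -2u: one factor exp(-u) absorbs y^4 = 16 s^4 u^2, the other is
   a Gaussian of variance 2 s^2. *)
pose u := y ^+ 2 / (s ^+ 2 *+ 4).
have u0 : 0 <= u by rewrite divr_ge0 ?mulrn_wge0 ?sqr_ge0.
have := sqr_expRN_le u0.
have -> : - y ^+ 2 / (s ^+ 2 *+ 2) = - u - u by rewrite /u; field.
have -> : - y ^+ 2 / (2 * s ^+ 2 *+ 2) = - u by rewrite /u; field.
rewrite expRD.
have -> : y ^+ 4 = 16 * s ^+ 4 * u ^+ 2 by rewrite /u; field.
move=> H.
have K : 0 <= 16 * s ^+ 4 * normal_peak s * expR (- u).
  rewrite mulr_ge0 ?expR_ge0// mulr_ge0 ?normal_peak_ge0// mulr_ge0//.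
  by rewrite exprn_even_ge0.
have := ler_wpM2l K H.
have s2 : Num.sqrt 2 != 0 :> R by rewrite gt_eqF// sqrtr_gt0.
have -> : 32 * Num.sqrt 2 * s ^+ 4 * (normal_peak s / Num.sqrt 2 * expR (- u)) =
   16 * s ^+ 4 * normal_peak s * expR (- u) * 2 by field.
by apply: le_trans; rewrite le_eqVlt; apply/orP; left; apply/eqP; ring.
Qed.

(** Each |y|^k with k <= 4 is at most 1 + y^4, so the integrand is dominated by a combination of two
    normal densities. *)
Lemma integrable_quartic_normal_pdf (m s q0 q1 q2 q3 q4 : R) : s != 0 ->
  mu.-integrable [set: R] (fun x => (
     (q0 + q1 * (x - m) + q2 * (x - m) ^+ 2 + q3 * (x - m) ^+ 3 + q4 * (x - m) ^+ 4)
     * normal_pdf m s x)%:E).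
Proof.
move=> s0; have s20 : Num.sqrt 2 * s != 0 by rewrite mulf_neq0// gt_eqF// sqrtr_gt0.
pose L := `|q0| + `|q1| + `|q2| + `|q3| + `|q4|.
pose G x := L * normal_pdf m s x +
  L * (32 * Num.sqrt 2 * s ^+ 4) * normal_pdf m (Num.sqrt 2 * s) x.
have iG : mu.-integrable [set: R] (fun x => (G x)%:E).
  rewrite (_ : (fun x => (G x)%:E) = (fun x => L%:E * (normal_pdf m s x)%:E) \+
    (fun x => (L * (32 * Num.sqrt 2 * s ^+ 4))%:E
       * (normal_pdf m (Num.sqrt 2 * s) x)%:E))%E; last first.
    by apply/funext => x; rewrite /G EFinD !EFinM.
  apply: integrableD => //.
    by apply: integrableZl => //; exact: integrable_normal_pdf.
  by apply: integrableZl => //; exact: integrable_normal_pdf.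
apply: le_integrable iG => //.
  apply/measurable_EFinP; apply: measurable_funM; last exact: measurable_normal_pdf.
  have my : measurable_fun [set: R] (fun x : R => x - m) by exact: measurable_funB.
  do 4 (apply: measurable_funD; last by apply: measurable_funM => //; exact: measurable_funX).
  by [].
move=> x _; rewrite /= lee_fin.
have [y ->] : exists y, x = m + y by exists (x - m); ring.
have := normal_pdf_expR4 m y s0; rewrite /G (addrC m) addrK (addrC y).
set N := normal_pdf m s _; set N2 := normal_pdf m _ _ => H.
have N0 : 0 <= N by exact: normal_pdf_ge0.
have N20 : 0 <= N2 by exact: normal_pdf_ge0.
have L0 : 0 <= L by rewrite !addr_ge0.
rewrite [leRHS]ger0_norm; last first.
  apply: addr_ge0; first exact: mulr_ge0.
  have s40 : 0 <= s ^+ 4 by rewrite exprn_even_ge0.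
  by do 4 (apply: mulr_ge0 => //); exact: sqrtr_ge0.
apply: (@le_trans _ _ (L * (1 + y ^+ 4) * N)); last first.
  have -> : L * (1 + y ^+ 4) * N = L * N + L * (y ^+ 4 * N) by ring.
  by rewrite lerD2l -(mulrA L) ler_wpM2l.
rewrite normrM (ger0_norm N0) ler_wpM2r//.
have y4 : 0 <= y ^+ 4 by rewrite exprn_even_ge0.
have b k : (k <= 4)%N -> `|y ^+ k| <= 1 + y ^+ 4.
  move=> k4; rewrite normrX -(ger0_norm y4) normrX.
  have [y1|y1] := lerP `|y| 1.
    by apply: (@le_trans _ _ 1); [exact: exprn_ile1|rewrite lerDl exprn_ge0].
  by rewrite (le_trans (ler_weXn2l (ltW y1) k4))// lerDr.
have -> : L * (1 + y ^+ 4) = `|q0| * (1 + y ^+ 4) + `|q1| * (1 + y ^+ 4)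
   + `|q2| * (1 + y ^+ 4) + `|q3| * (1 + y ^+ 4) + `|q4| * (1 + y ^+ 4).
  by rewrite /L; ring.
have c k q : (k <= 4)%N -> `|q * y ^+ k| <= `|q| * (1 + y ^+ 4).
  by move=> k4; rewrite normrM ler_wpM2l// b.
apply: (le_trans (ler_normD _ _)); apply: lerD; last exact: c.
apply: (le_trans (ler_normD _ _)); apply: lerD; last exact: c.
apply: (le_trans (ler_normD _ _)); apply: lerD; last exact: c.
apply: (le_trans (ler_normD _ _)); apply: lerD; last by have := c 1%N q1; rewrite expr1; apply.
by have := c 0%N q0; rewrite expr0 mulr1; apply.
Qed.

(** The sign [e] treats both tails at once. A cubic measured against the quartic bound leaves a
    factor 1 / (n + 1). *)
Lemma cubic_normal_pdf_cvg0 (m s q0 q1 q2 q3 e : R) : s != 0 -> e ^+ 2 = 1 ->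
  (q0 + q1 * (e * n.+1%:R) + q2 * (e * n.+1%:R) ^+ 2 + q3 * (e * n.+1%:R) ^+ 3)
    * normal_pdf m s (m + e * n.+1%:R) @[n --> \oo] --> 0.
Proof.
move=> s0 e1.
pose L := `|q0| + `|q1| + `|q2| + `|q3|.
pose K := L * (32 * Num.sqrt 2 * s ^+ 4 * normal_peak (Num.sqrt 2 * s)).
have s20 : Num.sqrt 2 * s != 0 by rewrite mulf_neq0// gt_eqF// sqrtr_gt0.
have L0 : 0 <= L by rewrite !addr_ge0.
apply/norm_cvg0P.
apply: (@squeeze_cvgr _ _ _ _ (fun=> 0) (fun n => K * (n.+1%:R)^-1)); last 2 first.
- exact: cvg_cst.
- rewrite -[X in _ --> X](mulr0 K); apply: cvgM; first exact: cvg_cst.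
  exact: cvg_harmonic.
near=> n; rewrite normr_ge0/=.
have n0 : 0 < n.+1%:R :> R by [].
have n1 : 1 <= n.+1%:R :> R by rewrite ler1n.
have := normal_pdf_expR4 m (e * n.+1%:R) s0.
have := normal_pdf_ub m (m + e * n.+1%:R) s20.
have := normal_pdf_ge0 m s (m + e * n.+1%:R).
set N := normal_pdf m s _; set N2 := normal_pdf m _ _ => N0 N2le H.
have e4 : e ^+ 4 = 1 by rewrite (exprM e 2 2) e1 expr1n.
rewrite exprMn e4 mul1r in H.
have en : `|e| = 1.
  by apply/eqP; rewrite -(@eqrXn2 _ 2)// ?expr1n -?normrX ?e1 ?normr1.
rewrite ler_pdivlMr// normrM (ger0_norm N0).
apply: (@le_trans _ _ (L * n.+1%:R ^+ 3 * N * n.+1%:R)).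
  rewrite !ler_wpM2r//.
  have c k q : (k <= 3)%N -> `|q * (e * n.+1%:R) ^+ k| <= `|q| * n.+1%:R ^+ 3.
    move=> k3; rewrite normrM normrX normrM en mul1r ler_wpM2l// ger0_norm//.
    exact: ler_weXn2l.
  rewrite /L !mulrDl.
  apply: (le_trans (ler_normD _ _)); apply: lerD; last exact: c.
  apply: (le_trans (ler_normD _ _)); apply: lerD; last exact: c.
  apply: (le_trans (ler_normD _ _)); apply: lerD; last by have := c 1%N q1; rewrite expr1; apply.
  by have := c 0%N q0; rewrite expr0 mulr1; apply.
rewrite (_ : _ * _ = L * (n.+1%:R ^+ 4 * N)); last by ring.
rewrite ler_wpM2l// (le_trans H)// ler_wpM2l//.
have s40 : 0 <= s ^+ 4 by rewrite exprn_even_ge0.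
by do 2 (apply: mulr_ge0 => //); exact: sqrtr_ge0.
Unshelve. all: by end_near. Qed.

(** The polynomials 1, x - m and (x - m)^2 - s^2 are orthogonal under N(m, s^2), hence the absence
    of cross terms. Subtracting the claimed value [C] leaves an integrand that is an exact
    derivative. *)
Lemma normal_prob_moment (m s a b c : R) : s != 0 ->
  (\int[normal_prob m s]_x
     ((a * ((x - m) ^+ 2 - s ^+ 2) + b * (x - m) + c) ^+ 2)%:E
   = (2 * a ^+ 2 * s ^+ 4 + b ^+ 2 * s ^+ 2 + c ^+ 2)%:E)%E.
Proof.
move=> s0.
have my : measurable_fun [set: R] (fun x : R => x - m) by exact: measurable_funB.
rewrite ge0_integral_normal_prob; last 2 first.
- apply/measurable_EFinP; apply: measurable_funX.
  apply: measurable_funD => //; apply: measurable_funD; apply: measurable_funM => //.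
  by apply: measurable_funB => //; exact: measurable_funX.
- by move=> x; rewrite lee_fin sqr_ge0.
set C := _ + c ^+ 2.
pose t := s ^+ 2.
(* The antiderivative vanishing at infinity of f is a cubic times the density; its
   coefficients solve [f = (Q' - Q (x - m) / s^2) normal_pdf]. *)
pose q3 := - t * a ^+ 2; pose q2 := - 2 * a * b * t.
pose q1 := - a ^+ 2 * t ^+ 2 - b ^+ 2 * t - 2 * a * c * t.
pose q0 := - 2 * a * b * t ^+ 2 - 2 * b * c * t.
pose F (x : R) :=
   (q0 + q1 * (x - m) + q2 * (x - m) ^+ 2 + q3 * (x - m) ^+ 3) * normal_pdf m s x.
pose f (x : R) := (((a * ((x - m) ^+ 2 - s ^+ 2) + b * (x - m) + c) ^+ 2) - C) * normal_pdf m s x.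
have fE (x : R) : f x =
  ((a ^+ 2 * t ^+ 2 - 2 * a * c * t + c ^+ 2 - C) + (2 * b * c - 2 * a * b * t) * (x - m)
   + (b ^+ 2 + 2 * a * c - 2 * a ^+ 2 * t) * (x - m) ^+ 2 + 2 * a * b * (x - m) ^+ 3
   + a ^+ 2 * (x - m) ^+ 4) * normal_pdf m s x.
  by rewrite /f /t; congr (_ * _); ring.
have intf : mu.-integrable [set: R] (EFin \o f).
  have -> : EFin \o f = (fun x => (
    ((a ^+ 2 * t ^+ 2 - 2 * a * c * t + c ^+ 2 - C) + (2 * b * c - 2 * a * b * t) * (x - m)
     + (b ^+ 2 + 2 * a * c - 2 * a ^+ 2 * t) * (x - m) ^+ 2 + 2 * a * b * (x - m) ^+ 3
     + a ^+ 2 * (x - m) ^+ 4) * normal_pdf m s x)%:E).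
    by apply/funext => x /=; rewrite fE.
  exact: integrable_quartic_normal_pdf.
have cvF e : e ^+ 2 = 1 -> F (m + e * n.+1%:R) @[n --> \oo] --> 0.
  move=> e1; rewrite (_ : (fun n => F (m + e * n.+1%:R)) = (fun n =>
    (q0 + q1 * (e * n.+1%:R) + q2 * (e * n.+1%:R) ^+ 2 + q3 * (e * n.+1%:R) ^+ 3)
    * normal_pdf m s (m + e * n.+1%:R))); first exact: cubic_normal_pdf_cvg0.
  apply/funext => n; rewrite /F.
  by have -> : m + e * n.+1%:R - m = e * n.+1%:R by ring.
have f0 : (\int[mu]_x (f x)%:E = 0)%E.
  apply: (@integral_derivative_eq0 m f F _ intf).
  - move=> x; apply: cvgM; last exact: continuous_normal_pdf.
    have cy : (fun x : R => x - m) @ x --> x - m.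
      by apply: cvgB; [exact: cvg_id|exact: cvg_cst].
    apply: cvgB; last exact: cvg_cst.
    apply: (cvg_comp _ (fun z : R => z ^+ 2) _ (@exprn_continuous _ 2 _)).
    apply: cvgD; last exact: cvg_cst.
    apply: cvgD; apply: cvgM; try exact: cvg_cst; last exact: cy.
    apply: cvgB; last exact: cvg_cst.
    exact: (cvg_comp _ (fun z : R => z ^+ 2) cy (@exprn_continuous _ 2 _)).
  - move=> x; have := is_derive_cubic_normal_pdf m q0 q1 q2 q3 x s0.
    set f' := (X in is_derive _ _ _ X -> _) => df.
    suff -> : f x = f' by [].
    by rewrite fE /f' /C /q0 /q1 /q2 /q3 /t; congr (_ * _); field.
  - have := cvF 1 (expr1n _ _).
    by under eq_fun do rewrite mul1r.
  - have := cvF (-1); rewrite sqrrN expr1n => /(_ erefl).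
    by under eq_fun do rewrite mulN1r.
transitivity (\int[mu]_x ((f x)%:E + C%:E * (normal_pdf m s x)%:E))%E.
  by apply: eq_integral => x _; rewrite -!EFinM -EFinD /f; congr (_%:E); ring.
rewrite integralD//; last by apply: integrableZl => //; exact: integrable_normal_pdf.
rewrite f0 add0e integralZl//; last exact: integrable_normal_pdf.
by rewrite integral_normal_pdf mule1.
Qed.

(** The ratio is kept as a single exponential so that, over several coordinates, it becomes the
    exponential of a sum. *)
Lemma normal_pdf_ratio (m0 s0 m1 s1 x : R) : 0 < s0 -> 0 < s1 ->
  normal_pdf m1 s1 x = normal_pdf m0 s0 x *
    expR (ln (s0 / s1) + (x - m0) ^+ 2 / (2 * s0 ^+ 2) - (x - m1) ^+ 2 / (2 * s1 ^+ 2)).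
Proof.
move=> p0 p1; have n0 := gt_eqF p0; have n1 := gt_eqF p1.
rewrite !normal_pdfE ?n0 ?n1// !expRD lnK ?posrE ?divr_gt0//.
rewrite /normal_fun.
have -> : - (x - m0) ^+ 2 / (s0 ^+ 2 *+ 2) = - ((x - m0) ^+ 2 / (2 * s0 ^+ 2)).
  by field; rewrite n0.
have -> : - (x - m1) ^+ 2 / (s1 ^+ 2 *+ 2) = - ((x - m1) ^+ 2 / (2 * s1 ^+ 2)).
  by field; rewrite n1.
rewrite !expRN.
have peak s : 0 < s -> normal_peak s = (s * Num.sqrt (pi *+ 2))^-1 :> R.
  by move=> p; rewrite /normal_peak -mulrnAr sqrtrM ?sqr_ge0// sqrtr_sqr gtr0_norm.
rewrite !peak//.
have e0 : expR ((x - m0) ^+ 2 / (2 * s0 ^+ 2)) != 0 by rewrite gt_eqF ?expR_gt0.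
have pi0 : Num.sqrt (pi *+ 2) != 0 :> R by rewrite gt_eqF// sqrtr_gt0 mulrn_wgt0// pi_gt0.
have e1 : expR ((x - m1) ^+ 2 / (2 * s1 ^+ 2)) != 0 by rewrite gt_eqF ?expR_gt0.
by field; rewrite e0 e1 pi0 n0 n1.
Qed.

End normal_moment.

(** * Isotropic Gaussian laws on column vectors *)

Section measurable_cV.
Context {R : realType}.

Lemma measurable_entry (m n : nat) (i : 'I_m) (j : 'I_n) :
  measurable_fun [set: 'M[R]_(m, n)] (fun M : 'M[R]_(m, n) => M i j).
Proof.
move=> _ C mC; rewrite setTI; apply: sub_sigma_algebra.
by exists i, j, C; split.
Qed.

Lemma measurable_fun_matrix d (T : measurableType d) (m n : nat)
    (f : T -> 'M[R]_(m, n)) :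
  (forall i j, measurable_fun [set: T] (fun x => f x i j)) ->
  measurable_fun [set: T] f.
Proof.
move=> mf; apply: (measurability [set B | exists i j (C : set R),
  measurable C /\ B = [set M : 'M[R]_(m, n) | C (M i j)]]) => //.
move=> _ [_ [i [j [C [mC ->]]]] <-].
exact: mf.
Qed.

(** The same stacking as in [lebesgue_integral_cV], so that the two recursions unfold alike. *)
Definition cons_cV (d : nat) (xv : measurableTypeR R * 'cV[R]_d) : 'cV[R]_d.+1 :=
  col_mx (const_mx (xv.1 : R) : 'cV[R]_1) xv.2.

Definition tail_cV (d : nat) (m : 'cV[R]_d.+1) : 'cV[R]_d :=
  \col_i m (lift ord0 i) 0.

Lemma cons_cV0 d (xv : measurableTypeR R * 'cV[R]_d) : cons_cV xv ord0 0 = xv.1.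
Proof.
have -> : ord0 = lshift d (ord0 : 'I_1) by exact: val_inj.
exact: (etrans (col_mxEu (const_mx (xv.1 : R) : 'cV_1) xv.2 ord0 0) (mxE _ _ _ _)).
Qed.

Lemma cons_cVS d (xv : measurableTypeR R * 'cV[R]_d) i : cons_cV xv (lift ord0 i) 0 = xv.2 i 0.
Proof.
have -> : lift ord0 i = rshift 1 i by exact: val_inj.
exact: (col_mxEd (const_mx (xv.1 : R) : 'cV_1) xv.2 i 0).
Qed.

Lemma measurable_cons_cV d : measurable_fun [set: measurableTypeR R * 'cV[R]_d] (@cons_cV d).
Proof.
apply: measurable_fun_matrix => i j; rewrite (ord1 j).
case: (unliftP ord0 i) => [k|] ->.
  under eq_fun do rewrite cons_cVS.
  exact: (measurableT_comp (measurable_entry k 0)).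
under eq_fun do rewrite cons_cV0.
exact: measurable_fst.
Qed.

HB.instance Definition _ d :=
  isMeasurableFun.Build _ _ _ _ (@cons_cV d) (@measurable_cons_cV d).

Lemma measurable_addZ_cV d (sigma : R) : measurable_fun [set: 'cV[R]_d * 'cV[R]_d]
  (fun xz => xz.1 + sigma *: xz.2).
Proof.
apply: measurable_fun_matrix => i j.
under eq_fun do rewrite mxE [X in _ + X]mxE.
apply: measurable_funD; first exact: (measurableT_comp (measurable_entry i j)).
apply: measurable_funM => //.
exact: (measurableT_comp (measurable_entry i j)).
Qed.

End measurable_cV.

(** * Isotropic Gaussians coordinate by coordinate: density, convolution, moments, likelihood
    ratio *)

Section gaussian.
Context {R : realType}.
Implicit Types s : R.

(* N(m, s^2 I), built along the same recursion as [lebesgue_integral_cV] so that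
   Tonelli's theorem applies one coordinate at a time. *)
Fixpoint gaussian (d : nat) : 'cV[R]_d -> R -> probability 'cV[R]_d R :=
  match d with
  | 0%N => fun _ _ => dirac (0 : 'cV[R]_0)
  | d'.+1 => fun m s =>
      distribution (normal_prob (m ord0 0%R) s \x gaussian (tail_cV m) s)%E
        (@cons_cV R d')
  end.

Lemma measurable_fun_cV0 (g : 'cV[R]_0 -> \bar R) : measurable_fun [set: 'cV[R]_0] g.
Proof.
rewrite (_ : g = cst (g 0)); first exact: measurable_cst.
by apply/funext => x; rewrite [x]flatmx0.
Qed.

Lemma ge0_integral_gaussianS d (m : 'cV[R]_d.+1) s (f : 'cV[R]_d.+1 -> \bar R) :
  measurable_fun [set: 'cV[R]_d.+1] f -> (forall x, 0 <= f x)%E ->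
  (\int[gaussian m s]_x f x =
   \int[normal_prob (m ord0 0%R) s]_x \int[gaussian (tail_cV m) s]_v f (cons_cV (x, v)))%E.
Proof.
move=> mf f0 /=.
rewrite (ge0_integral_pushforward (@measurable_cons_cV R d) _ measurableT mf); last first.
  by move=> y _.
rewrite preimage_setT.
have mg : measurable_fun [set: measurableTypeR R * 'cV[R]_d] (f \o @cons_cV R d).
  by apply: measurableT_comp => //; exact: measurable_cons_cV.
exact: (@fubini_tonelli1 _ _ _ _ _ (normal_prob (m ord0 0%R) s) (gaussian (tail_cV m) s)
  (f \o @cons_cV R d) mg (fun xv => f0 _)).
Qed.

Lemma mvnormal_pdf_prod d (m x : 'cV[R]_d) s : 0 < s ->
  mvnormal_pdf m (s ^+ 2)%:M x = \prod_(i < d) normal_pdf (m i 0) s (x i 0).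
Proof.
move=> s0; have n0 : s != 0 by rewrite gt_eqF.
under eq_bigr do rewrite normal_pdfE//.
rewrite big_split/= prodr_const card_ord /mvnormal_pdf; congr (_ * _).
  rewrite det_scalar -exprMn /normal_peak exprVn; congr (_^-1).
  rewrite (_ : s ^+ 2 * pi *+ 2 = 2 * pi * s ^+ 2); last by ring.
  have K : 0 <= 2 * pi * s ^+ 2.
    by apply: mulr_ge0; [apply: mulr_ge0 => //; exact: pi_ge0|exact: sqr_ge0].
  elim: d {m x} => [|d IH]; first by rewrite !expr0 sqrtr1.
  by rewrite [in LHS]exprS sqrtrM// IH -exprS.
rewrite /normal_fun -expR_sum; congr expR.
rewrite invmx_scalar /scal mul_mx_scalar -scalemxAl mxE mxE mulr_sumr mulr_sumr.
apply: eq_bigr => i _; rewrite !mxE.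
by field.
Qed.

(** The factor [c] makes the induction go through: fixing the first coordinate multiplies the
    remaining integrand by its density. *)
Lemma lebesgue_integral_cV_gaussian d (m : 'cV[R]_d) s (B : set 'cV[R]_d) (c : R) :
  0 < s -> measurable B -> 0 <= c ->
  lebesgue_integral_cV (fun x => (c * (\1_B x * mvnormal_pdf m (s ^+ 2)%:M x))%:E)
  = (c%:E * gaussian m s B)%E.
Proof.
move=> s0; elim: d m B c => [|d IH] m B c mB c0 /=.
  by rewrite mvnormal_pdf_prod// big_ord0 mulr1 diracE EFinM indicE.
pose Bx (x : R) : set 'cV[R]_d := [set v | B (cons_cV (x, v))].
have mBx x : measurable (Bx x).
  rewrite (_ : Bx x = xsection (@cons_cV R d @^-1` B) x); last first.
    by apply/seteqP; split=> v /=; rewrite /xsection/= inE.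
  apply: measurable_xsection.
  by rewrite -[X in measurable X]setTI; exact: measurable_cons_cV.
transitivity (\int[lebesgue_measure]_(x in [set: R])
   (c%:E * (gaussian (tail_cV m) s (Bx x) * (normal_pdf (m ord0 0) s x)%:E)))%E.
  apply: eq_integral => x _.
  rewrite (muleC (gaussian _ _ _)) muleA -EFinM -IH//; last by rewrite mulr_ge0// normal_pdf_ge0.
  congr lebesgue_integral_cV; apply/funext => v; congr (_%:E).
  rewrite !mvnormal_pdf_prod// big_ord_recl.
  rewrite -/(cons_cV (x, v)) cons_cV0.
  under eq_bigr do rewrite cons_cVS.
  under [in RHS]eq_bigr do rewrite mxE.
  rewrite (_ : \1_B (cons_cV (x, v)) = \1_(Bx x) v :> R); first by ring.
  by rewrite !indicE; congr (_%:R); congr nat_of_bool; apply/idP/idP; rewrite !inE.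
have mg : measurable_fun [set: R] (fun x : R => gaussian (tail_cV m) s (Bx x)).
  have := @measurable_fun_xsection _ _ (measurableTypeR R) _ R (gaussian (tail_cV m) s) (@cons_cV R d @^-1` B).
  rewrite (_ : _ \o _ = (fun x : R => gaussian (tail_cV m) s (Bx x))); last first.
    apply/funext => x /=; congr (gaussian _ _ _).
    by apply/seteqP; split=> v /=; rewrite /xsection/= inE.
  apply.
  by rewrite -[X in measurable X]setTI; exact: measurable_cons_cV.
rewrite ge0_integralZl//; last 2 first.
- by apply: emeasurable_funM => //; apply/measurable_EFinP; exact: measurable_normal_pdf.
- by move=> x _; rewrite mule_ge0// lee_fin normal_pdf_ge0.
congr (_ * _)%E.
rewrite -(@ge0_integral_normal_prob _ _ _ (fun x : R => gaussian (tail_cV m) s (Bx x)))//.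
apply: eq_integral => x _ /=; congr (gaussian _ _ _).
by apply/seteqP; split=> v /=; rewrite /xsection/= inE.
Qed.

Lemma mvnormal_gaussian d (m : 'cV[R]_d) s (B : set 'cV[R]_d) :
  0 < s -> measurable B -> mvnormal m (s ^+ 2)%:M B = gaussian m s B.
Proof.
move=> s0 mB; rewrite -[RHS]mul1e -(lebesgue_integral_cV_gaussian m s0 mB ler01).
by congr lebesgue_integral_cV; apply/funext => x; rewrite mul1r.
Qed.

Lemma measurable_cons_r d (x : R) : measurable_fun [set: 'cV[R]_d] (fun v => cons_cV (x, v)).
Proof. by apply: measurableT_comp; [exact: measurable_cons_cV|exact: measurable_pair1]. Qed.

(** Splitting off first coordinates leaves the order x0, v, z0, w; exchanging v and z0 pairs each
    part with its own noise, for the one-dimensional case and the induction hypothesis. *)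
Lemma ge0_gaussian_conv d (m : 'cV[R]_d) (s sigma t : R) (f : 'cV[R]_d -> \bar R) :
  s != 0 -> sigma != 0 -> t != 0 -> s ^+ 2 + sigma ^+ 2 = t ^+ 2 ->
  measurable_fun [set: 'cV[R]_d] f -> (forall x, 0 <= f x)%E ->
  (\int[gaussian m s]_x \int[gaussian 0 1]_z f (x + sigma *: z)%R
   = \int[gaussian m t]_x f x)%E.
Proof.
move=> s0 g0 t0 st; elim: d m f => [|d IH] m f mf f0.
  rewrite /= !integral_dirac ?diracT ?mul1e ?scaler0 ?addr0//.
  - exact: measurable_fun_cV0.
  - exact: measurable_fun_cV0.
pose mt := tail_cV m.
have t00 : tail_cV (0 : 'cV[R]_d.+1) = 0 by apply/colP => i; rewrite !mxE.
have msum : measurable_fun [set: 'cV[R]_d.+1 * 'cV[R]_d.+1] (fun xz => f (xz.1 + sigma *: xz.2)).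
  by apply: measurableT_comp => //; exact: measurable_addZ_cV.
have mz x : measurable_fun [set: 'cV[R]_d.+1] (fun z => f (x + sigma *: z)).
  exact: (measurableT_comp msum (measurable_pair1 x)).
have consD x0 v z0 w : cons_cV (x0, v) + sigma *: cons_cV (z0, w) =
    cons_cV (x0 + sigma * z0, v + sigma *: w).
  apply/colP => i; rewrite [LHS]mxE [X in _ + X]mxE.
  by case: (unliftP ord0 i) => [k|] ->; rewrite ?cons_cVS ?cons_cV0// !mxE.
pose If (x : 'cV[R]_d.+1) := (\int[gaussian 0 1]_z f (x + sigma *: z)%R)%E.
have mIf : measurable_fun [set: 'cV[R]_d.+1] If.
  exact: (@measurable_fun_fubini_tonelli_F _ _ _ _ _ (gaussian 0 1) _ msum (fun _ => f0 _)).
have If0 x : (0 <= If x)%E by exact: integral_ge0.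
transitivity (\int[normal_prob (m ord0 0%R) s]_x \int[gaussian mt s]_v If (cons_cV (x, v)))%E.
  exact: (ge0_integral_gaussianS m s mIf If0).
transitivity (\int[normal_prob (m ord0 0%R) s]_x0 \int[normal_prob 0 1]_z0
   \int[gaussian mt s]_v \int[gaussian 0 1]_w f (cons_cV ((x0 + sigma * z0)%R, (v + sigma *: w)%R)))%E.
  apply: eq_integral => x0 _.
  transitivity (\int[gaussian mt s]_v \int[normal_prob 0 1]_z0
     \int[gaussian 0 1]_w f (cons_cV ((x0 + sigma * z0)%R, (v + sigma *: w)%R)))%E.
    apply: eq_integral => v _.
    rewrite /If (ge0_integral_gaussianS 0 1 (mz (cons_cV (x0, v))) (fun=> f0 _)).
    rewrite t00 mxE; apply: eq_integral => z0 _; apply: eq_integral => w _.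
    by rewrite consD.
  pose h (vzw : ('cV[R]_d * R) * 'cV[R]_d) :=
    f (cons_cV (x0 + sigma * vzw.1.2, vzw.1.1 + sigma *: vzw.2)).
  have mh : measurable_fun [set: ('cV[R]_d * measurableTypeR R) * 'cV[R]_d] h.
    apply: measurableT_comp => //; apply: measurableT_comp; first exact: measurable_cons_cV.
    apply/measurable_fun_pairP; split => /=.
      apply: measurable_funD => //; apply: measurable_funM => //.
      by apply: measurableT_comp => //.
    have mp : measurable_fun [set: ('cV[R]_d * measurableTypeR R) * 'cV[R]_d]
        (fun x => (x.1.1, x.2)).
      apply: measurable_fun_pair; last exact: measurable_snd.
      exact: (measurableT_comp measurable_fst measurable_fst).
    exact: (measurableT_comp (measurable_addZ_cV sigma) mp).
  pose H (vz : 'cV[R]_d * measurableTypeR R) := (\int[gaussian 0 1]_w h (vz, w))%E.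
  have mH : measurable_fun [set: 'cV[R]_d * measurableTypeR R] H.
    exact: (@measurable_fun_fubini_tonelli_F _ _ _ _ _ (gaussian 0 1) h mh (fun _ => f0 _)).
  have H0 vz : (0 <= H vz)%E by apply: integral_ge0 => w _; exact: f0.
  exact: (@fubini_tonelli _ _ _ _ _ (gaussian mt s) (normal_prob 0 1) H mH H0).
pose G (y0 : R) := (\int[gaussian mt t]_y f (cons_cV (y0, y)))%E.
have mfc y0 : measurable_fun [set: 'cV[R]_d] (fun y => f (cons_cV (y0, y))).
  by apply: measurableT_comp => //; exact: measurable_cons_r.
have mG : measurable_fun [set: R] G.
  have mfcc : measurable_fun [set: measurableTypeR R * 'cV[R]_d] (f \o @cons_cV R d).
    by apply: measurableT_comp => //; exact: measurable_cons_cV.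
  exact: (@measurable_fun_fubini_tonelli_F _ _ _ _ _ (gaussian mt t) _ mfcc (fun _ => f0 _)).
transitivity (\int[normal_prob (m ord0 0%R) s]_x0 \int[normal_prob 0 1]_z0 G (x0 + sigma * z0)%R)%E.
  apply: eq_integral => x0 _; apply: eq_integral => z0 _.
  exact: (IH mt (fun y => f (cons_cV (x0 + sigma * z0, y))) (mfc _) (fun _ => f0 _)).
rewrite (ge0_normal_prob_conv _ s0 g0 t0 st mG); last by move=> y0; exact: integral_ge0.
exact/esym/(ge0_integral_gaussianS m t mf f0).
Qed.

(** The induction is over all [c]: once the first coordinate is fixed, its contribution [e x0] joins
    the constant of the remaining ones. *)
Lemma gaussian_moment d (m beta : 'cV[R]_d) (s a c : R) : s != 0 ->
  (\int[gaussian m s]_x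
     ((\sum_(i < d) (a * ((x i 0 - m i 0) ^+ 2 - s ^+ 2) + beta i 0 * (x i 0 - m i 0))
       + c) ^+ 2)%:E
   = (2 * a ^+ 2 * s ^+ 4 * d%:R + s ^+ 2 * \sum_(i < d) beta i 0 ^+ 2 + c ^+ 2)%:E)%E.
Proof.
move=> s0; elim: d m beta c => [|d IH] m beta c.
  rewrite /= integral_dirac ?diracT ?mul1e ?big_ord0//; first by congr (_%:E); ring.
  exact: measurable_fun_cV0.
have mentry i : measurable_fun [set: 'cV[R]_d.+1] (fun x => x i 0).
  exact: measurable_entry.
pose q (x : 'cV[R]_d.+1) := (((\sum_(i < d.+1) (a * ((x i 0 - m i 0) ^+ 2 - s ^+ 2)
  + beta i 0 * (x i 0 - m i 0)) + c) ^+ 2)%:E)%E.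
have mq : measurable_fun [set: 'cV[R]_d.+1] q.
  apply/measurable_EFinP; apply: measurable_funX; apply: measurable_funD => //.
  apply: measurable_sum => i; apply: measurable_funD; apply: measurable_funM => //.
    by apply: measurable_funB => //; apply: measurable_funX; exact: measurable_funB.
  exact: measurable_funB.
have q0 x : (0 <= q x)%E by rewrite lee_fin sqr_ge0.
rewrite (ge0_integral_gaussianS m s mq q0).
pose e x0 := a * ((x0 - m ord0 0) ^+ 2 - s ^+ 2) + beta ord0 0 * (x0 - m ord0 0).
pose K := 2 * a ^+ 2 * s ^+ 4 * d%:R + s ^+ 2 * \sum_(i < d) tail_cV beta i 0 ^+ 2.
transitivity (\int[normal_prob (m ord0 0%R) s]_x0 (K%:E + ((e x0 + c) ^+ 2)%:E))%E.
  apply: eq_integral => x0 _; rewrite -EFinD.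
  rewrite -(IH (tail_cV m) (tail_cV beta) (e x0 + c)).
  apply: eq_integral => v _; congr (_%:E); congr (_ ^+ 2).
  rewrite big_ord_recl cons_cV0 -/(e x0) -addrA addrCA; congr (_ + _).
  by apply: eq_bigr => i _; rewrite cons_cVS !mxE.
have K0 : 0 <= K.
  have s40 : 0 <= s ^+ 4 by rewrite exprn_even_ge0.
  apply: addr_ge0; first by do 3 (apply: mulr_ge0 => //); exact: sqr_ge0.
  by apply: mulr_ge0; [exact: sqr_ge0|apply: sumr_ge0 => i _; exact: sqr_ge0].
rewrite ge0_integralD//; last 2 first.
- by move=> x _; rewrite lee_fin sqr_ge0.
- apply/measurable_EFinP; apply: measurable_funX; apply: measurable_funD => //.
  apply: measurable_funD; apply: measurable_funM => //.
    by apply: measurable_funB => //; apply: measurable_funX; exact: measurable_funB.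
  exact: measurable_funB.
rewrite integral_cst//= probability_setT mule1 /e normal_prob_moment// -EFinD.
rewrite big_ord_recl /K; congr (_%:E).
under eq_bigr do rewrite mxE.
by rewrite -natr1; ring.
Qed.

(** The logarithm of the N(m1, s1^2) density over the N(m0, s0^2) density at x. *)
Definition log_density_ratio (m0 s0 m1 s1 x : R) : R :=
  ln (s0 / s1) + (x - m0) ^+ 2 / (2 * s0 ^+ 2) - (x - m1) ^+ 2 / (2 * s1 ^+ 2).

Lemma measurable_log_density_ratio (m0 s0 m1 s1 : R) :
  measurable_fun [set: R] (log_density_ratio m0 s0 m1 s1).
Proof.
apply: measurable_funB; first apply: measurable_funD => //.
  by apply: measurable_funM => //; apply: measurable_funX; exact: measurable_funB.
by apply: measurable_funM => //; apply: measurable_funX; exact: measurable_funB.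
Qed.

(** Change of measure by the likelihood ratio, made one coordinate at a time with
    [normal_pdf_ratio]. *)
Lemma ge0_gaussian_change d (m0 m1 : 'cV[R]_d) (s0 s1 : R) (f : 'cV[R]_d -> \bar R) :
  0 < s0 -> 0 < s1 ->
  measurable_fun [set: 'cV[R]_d] f -> (forall x, 0 <= f x)%E ->
  (\int[gaussian m1 s1]_x f x = \int[gaussian m0 s0]_x (f x *
     (expR (\sum_(i < d) log_density_ratio (m0 i 0) s0 (m1 i 0) s1 (x i 0)))%:E))%E.
Proof.
move=> p0 p1; elim: d m0 m1 f => [|d IH] m0 m1 f mf f0.
  rewrite /= !integral_dirac ?diracT ?mul1e ?big_ord0 ?expR0 ?mule1//.
  exact: measurable_fun_cV0.
have mL k (u0 u1 : 'cV[R]_k) : measurable_fun [set: 'cV[R]_k] (fun x => (expR (\sum_(i < k)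
   log_density_ratio (u0 i 0) s0 (u1 i 0) s1 (x i 0)))%:E).
  apply/measurable_EFinP; apply: measurableT_comp => //.
  apply: measurable_sum => i; apply: (measurableT_comp (measurable_log_density_ratio _ _ _ _)).
  exact: measurable_entry.
have mfc y0 : measurable_fun [set: 'cV[R]_d] (fun y => f (cons_cV (y0, y))).
  by apply: measurableT_comp => //; exact: measurable_cons_r.
have mfcc : measurable_fun [set: measurableTypeR R * 'cV[R]_d] (f \o @cons_cV R d).
  by apply: measurableT_comp => //; exact: measurable_cons_cV.
pose g (x : 'cV[R]_d.+1) := (f x *
  (expR (\sum_(i < d.+1) log_density_ratio (m0 i 0) s0 (m1 i 0) s1 (x i 0)))%:E)%E.
have mg : measurable_fun [set: 'cV[R]_d.+1] g.
  exact: (emeasurable_funM mf (mL _ m0 m1)).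
have g0 x : (0 <= g x)%E by rewrite mule_ge0// lee_fin expR_ge0.
apply: (etrans (ge0_integral_gaussianS m1 s1 mf f0)); apply: esym.
apply: (etrans (ge0_integral_gaussianS m0 s0 mg g0)); apply: esym.
pose L (v : 'cV[R]_d) := expR (\sum_(i < d) log_density_ratio (tail_cV m0 i 0) s0 (tail_cV m1 i 0) s1 (v i 0)).
pose J x0 := (\int[gaussian (tail_cV m0) s0]_v (f (cons_cV (x0, v)) * (L v)%:E))%E.
have mJ : measurable_fun [set: R] J.
  have mfL : measurable_fun [set: measurableTypeR R * 'cV[R]_d]
      (fun xv => (f (cons_cV xv) * (L xv.2)%:E)%E).
    apply: emeasurable_funM => //.
    exact: (measurableT_comp (mL d (tail_cV m0) (tail_cV m1))).
  apply: (@measurable_fun_fubini_tonelli_F _ _ _ _ _ (gaussian (tail_cV m0) s0) _ mfL).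
  by move=> x; rewrite mule_ge0// lee_fin expR_ge0.
have J0 x0 : (0 <= J x0)%E.
  by apply: integral_ge0 => v _; rewrite mule_ge0// lee_fin expR_ge0.
pose l x0 := log_density_ratio (m0 ord0 0) s0 (m1 ord0 0) s1 x0.
have ml : measurable_fun [set: R] (fun x => (expR (l x))%:E).
  apply/measurable_EFinP; apply: measurableT_comp => //.
  exact: measurable_log_density_ratio.
transitivity (\int[normal_prob (m1 ord0 0%R) s1]_x0 J x0)%E.
  by apply: eq_integral => x0 _; exact: IH.
transitivity (\int[normal_prob (m0 ord0 0%R) s0]_x0 (J x0 * (expR (l x0))%:E))%E.
  rewrite (ge0_integral_normal_prob _ s1 mJ J0).
  rewrite (@ge0_integral_normal_prob R (m0 ord0 0) s0 (fun x => J x * (expR (l x))%:E)%E); last 2 first.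
  - exact: (emeasurable_funM mJ ml).
  - by move=> x; rewrite mule_ge0// lee_fin expR_ge0.
  apply: eq_integral => x0 _; rewrite -muleA -EFinM; congr (_ * _%:E)%E.
  by rewrite (normal_pdf_ratio (m0 ord0 0) _ _ p0 p1) mulrC.
apply: eq_integral => x0 _; rewrite /J -ge0_integralZr//; last 2 first.
- exact: (emeasurable_funM (mfc x0) (mL _ (tail_cV m0) (tail_cV m1))).
- by move=> v _; rewrite mule_ge0// lee_fin expR_ge0.
apply: eq_integral => v _.
rewrite /g -muleA -EFinM -expRD big_ord_recl cons_cV0; congr (_ * (expR _)%:E)%E.
rewrite addrC; congr (_ + _).
by apply: eq_bigr => i _; rewrite cons_cVS !mxE.
Qed.

End gaussian.

(** * The posterior and the approximation error *)

Section sigmoid.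
Context {R : realType}.

Lemma sigmoid_gt0 (z : R) : 0 < sigmoid z.
Proof. by rewrite invr_gt0 ltr_wpDr ?expR_ge0. Qed.

Lemma sigmoid_le1 (z : R) : sigmoid z <= 1.
Proof. by rewrite invf_le1 ?lerDl ?expR_ge0// ltr_wpDr ?expR_ge0. Qed.

Lemma sigmoidE (z : R) : sigmoid z = expR z / (1 + expR z).
Proof.
rewrite /sigmoid expRN; have e0 : 0 < expR z by exact: expR_gt0.
have e1 : 1 + expR z != 0 by rewrite gt_eqF// ltr_pwDl.
by field; rewrite e1 gt_eqF.
Qed.

Lemma measurable_sigmoid : measurable_fun [set: R] (@sigmoid R).
Proof.
rewrite (_ : @sigmoid R = (fun z => (1 + expR (- z))^-1))//.
apply: continuous_measurable_fun => z.
apply: cvgV; first by rewrite gt_eqF// ltr_pwDl// expR_ge0.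
apply: cvgD; first exact: cvg_cst.
apply: (cvg_comp _ expR); last exact: continuous_expR.
by apply: cvgN; exact: cvg_id.
Qed.

(** Mean value theorem: with e = exp(-z) the derivative is e / (1 + e)^2, at most 1/2 since (1 +
    e)^2 >= 2 e. The square of 1/2 is the prefactor of [eps_CCG]. *)
Lemma sigmoid_lipschitz (u v : R) : (sigmoid u - sigmoid v) ^+ 2 <= 4^-1 * (u - v) ^+ 2.
Proof.
wlog vu : u v / v <= u.
  move=> H; have [/H//|/ltW/H] := leP v u.
  by rewrite -sqrrN opprB -(sqrrN (v - u)) opprB.
pose df (z : R) := expR (- z) * (1 + expR (- z)) ^- 2.
have pos (z : R) : 0 < 1 + expR (- z) by rewrite ltr_pwDl// expR_ge0.
have dF (z : R) : is_derive z 1 (@sigmoid R) (df z).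
  have d1 : is_derive z 1 (fun y : R => - y) (-1) by apply: is_derive_eq.
  have d2 := @is_derive1_comp _ _ _ _ _ _ (is_derive_expR _) d1.
  have d3 : is_derive z 1 (fun y : R => 1 + expR (- y)) (- expR (- z)).
    by apply: is_derive_eq; rewrite add0r mul1r mulrN1.
  have n0 : 1 + expR (- z) != 0 by rewrite gt_eqF.
  have d4 := is_deriveV (f := fun y => 1 + expR (- y)) n0 d3.
  apply: is_derive_eq.
  by rewrite /df /GRing.scale/= mulrN mulNr opprK mulrC.
have cF : {within `[v, u], continuous (@sigmoid R)}.
  apply: continuous_subspaceT => z.
  by apply: differentiable_continuous; apply/derivable1_diffP; have [] := dF z.
have [c _ ->] := MVT_segment vu (fun z _ => dF z) cF.
rewrite exprMn ler_wpM2r ?sqr_ge0//.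
have e0 : 0 < expR (- c) by exact: expR_gt0.
have h : df c <= 2^-1.
  rewrite /df ler_pdivrMr ?exprn_gt0// mulrC ler_pdivlMr//.
  by nra.
have h0 : 0 <= df c by rewrite /df divr_ge0 ?expR_ge0// exprn_ge0// ltW.
rewrite (_ : 4^-1 = 2^-1 ^+ 2) ?ler_sqr ?nnegrE//.
by field.
Qed.

End sigmoid.

(** * The Gaussian mixture: posterior, error decomposition, affine gap *)

Section noisy_mixture.
Context {R : realType} {disp : measure_display} {Omega : measurableType disp}.
Context (P : probability Omega R) (d : nat) (p sigma : R).
Context (mu : bool -> 'cV[R]_d) (sg : bool -> R).
Context (S : {RV P >-> bool}) (X Z : {RV P >-> 'cV[R]_d}).
Hypotheses (p_gt0 : 0 < p) (p_lt1 : p < 1).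
Hypothesis hsg : forall k, 0 < sg k.
Hypothesis hsigma : 0 < sigma.
Hypothesis hS : forall B : set bool, P (S @^-1` B) = bernoulli_prob p B.
Hypothesis hX : forall (k : bool) (B : set 'cV[R]_d), measurable B ->
  (cond_prob P (X @^-1` B) (S @^-1` [set k]))%:E = mvnormal (mu k) ((sg k ^+ 2)%:M) B.
Hypothesis hZ : forall B : set 'cV[R]_d, measurable B ->
  P (Z @^-1` B) = mvnormal 0 1%:M B.
Hypothesis hZind : independent P Z (fun w => (X w, S w)).

Let tau (k : bool) : R := Num.sqrt (sg k ^+ 2 + sigma ^+ 2).
Let nu (k : bool) : probability 'cV[R]_d R := gaussian (mu k) (tau k).
Let pr (k : bool) : R := if k then p else 1 - p.
Let Xs := noisy sigma X Z.

Let pr_gt0 k : 0 < pr k.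
Proof. by rewrite /pr; case: k; rewrite ?subr_gt0. Qed.

Let tau_gt0 k : 0 < tau k.
Proof. by rewrite sqrtr_gt0 ltr_pwDl ?exprn_gt0// sqr_ge0. Qed.

Let tau2 k : sg k ^+ 2 + sigma ^+ 2 = tau k ^+ 2.
Proof. by rewrite sqr_sqrtr// addr_ge0 ?sqr_ge0. Qed.

Let PS k : P (S @^-1` [set k]) = (pr k)%:E.
Proof.
rewrite hS bernoulli_probE; last by rewrite !ltW.
have D (a b : bool) : \d_a [set b] = ((a == b)%:R)%:E :> \bar R.
  rewrite diracE; congr ((nat_of_bool _)%:R%:E).
  by apply/idP/eqP => [/set_mem//|->]; exact: mem_set.
by rewrite !D /pr; case: k; rewrite /= ?mule1 ?mule0 ?adde0 ?add0e.
Qed.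

Let measX : measurable_fun [set: Omega] X. Proof. exact: measurable_funPT. Qed.
Let measZ : measurable_fun [set: Omega] Z. Proof. exact: measurable_funPT. Qed.
Let measS : measurable_fun [set: Omega] S. Proof. exact: measurable_funPT. Qed.

Let measXs : measurable_fun [set: Omega] Xs.
Proof.
apply: (measurableT_comp (measurable_addZ_cV sigma) (g := fun w => (X w, Z w))).
exact: measurable_fun_pair.
Qed.

Let joint_law k (B : set 'cV[R]_d) : measurable B ->
  P (X @^-1` B `&` S @^-1` [set k]) = ((pr k)%:E * gaussian (mu k) (sg k) B)%E.
Proof.
move=> mB; rewrite -mvnormal_gaussian// -hX// /cond_prob PS/= -EFinM.
rewrite mulrCA divff ?gt_eqF// mulr1 fineK// fin_num_measure//.
apply: measurableI; rewrite -[X in measurable X]setTI.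
  exact: measX.
exact: measS.
Qed.

(** Independence makes the law of (Z, (X, S)) a product measure. The section of the event at a fixed
    z is a translated event for (X, S), given by [joint_law]; integrating over z is the Gaussian
    convolution. *)
Let noisy_law k (B : set 'cV[R]_d) : measurable B ->
  P (Xs @^-1` B `&` S @^-1` [set k]) = ((pr k)%:E * nu k B)%E.
Proof.
move=> mB.
pose XS w := (X w, S w).
have mXS : measurable_fun [set: Omega] XS by exact: measurable_fun_pair.
pose ZXS w := (Z w, XS w).
have mZXS : measurable_fun [set: Omega] ZXS by exact: measurable_fun_pair.
pose XSm : {mfun Omega >-> ('cV[R]_d * bool)%type} :=
  HB.pack XS (isMeasurableFun.Build _ _ _ _ _ mXS).
pose m2 := distribution P XSm.
pose f (y : 'cV[R]_d) : \bar R := (\1_B y)%:E.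
have mf : measurable_fun [set: 'cV[R]_d] f by apply/measurable_EFinP; exact: measurable_indic.
have f0 y : (0 <= f y)%E by rewrite lee_fin.
pose E := [set zxs : 'cV[R]_d * ('cV[R]_d * bool) |
  B (zxs.2.1 + sigma *: zxs.1) /\ zxs.2.2 = k].
have mE : measurable E.
  pose h (zxs : 'cV[R]_d * ('cV[R]_d * bool)) := (zxs.2.1 + sigma *: zxs.1, zxs.2.2).
  have mh : measurable_fun [set: 'cV[R]_d * ('cV[R]_d * bool)] h.
    apply: measurable_fun_pair; last exact: (measurableT_comp measurable_snd measurable_snd).
    apply: (measurableT_comp (measurable_addZ_cV sigma)
      (g := fun zxs : 'cV[R]_d * ('cV[R]_d * bool) => (zxs.2.1, zxs.1))).
    apply: measurable_fun_pair; last exact: measurable_fst.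
    exact: (measurableT_comp measurable_fst measurable_snd).
  rewrite (_ : E = [set: _] `&` h @^-1` (B `*` [set k])); last first.
    by rewrite setTI; apply/seteqP; split.
  by apply: mh => //; exact: measurableX.
have prodE A : measurable A -> (gaussian 0 1 \x m2)%E A = P (ZXS @^-1` A).
  apply: (product_measure_unique (m' := pushforward P ZXS)) => C D mC mD.
  have gC := mvnormal_gaussian 0 ltr01 mC; rewrite expr1n -hZ// in gC.
  by apply: (etrans (hZind mC mD)); congr (_ * _)%E; exact: gC.
transitivity (P (ZXS @^-1` E)).
  by congr (P _); apply/seteqP; split.
rewrite -prodE//.
have mh : measurable_fun [set: 'cV[R]_d * 'cV[R]_d] (fun xz => f (xz.1 + sigma *: xz.2)).
  by apply: measurableT_comp => //; exact: measurable_addZ_cV.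
have mG : measurable_fun [set: 'cV[R]_d]
    (fun z => \int[gaussian (mu k) (sg k)]_x f (x + sigma *: z)%R)%E.
  exact: (@measurable_fun_fubini_tonelli_G _ _ _ _ _ (gaussian (mu k) (sg k)) _ mh (fun _ => f0 _)).
transitivity (\int[gaussian 0 1]_z
    ((pr k)%:E * \int[gaussian (mu k) (sg k)]_x f (x + sigma *: z)%R))%E.
  apply: eq_integral => z _ /=.
  pose Bz := [set x : 'cV[R]_d | B (x + sigma *: z)].
  have mBz : measurable Bz.
    rewrite (_ : Bz = [set: _] `&` (fun x => x + sigma *: z) @^-1` B); last by rewrite setTI.
    have mz : measurable_fun [set: 'cV[R]_d] (fun x => x + sigma *: z).
      exact: (measurableT_comp (measurable_addZ_cV sigma) (measurable_pair2 z)).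
    by apply: mz => //.
  transitivity (P (X @^-1` Bz `&` S @^-1` [set k])).
    congr (P _); apply/seteqP; split => w /=.
      by rewrite /xsection/= inE.
    by rewrite /xsection/= inE.
  rewrite joint_law//; congr (_ * _)%E.
  rewrite (_ : (fun x => f (x + sigma *: z)%R) = (fun x => (\1_Bz x)%:E)); last first.
    apply/funext => x; rewrite /f !indicE.
    by have -> : (x + sigma *: z \in B) = (x \in Bz) by apply/idP/idP; rewrite !inE.
  by rewrite integral_indic// setIT.
rewrite ge0_integralZl//; last 2 first.
- by move=> z _; exact: integral_ge0.
- by rewrite lee_fin ltW.
congr (_ * _)%E.
rewrite -(@fubini_tonelli _ _ _ _ _ (gaussian (mu k) (sg k)) (gaussian 0 1) _ mh (fun _ => f0 _)).
rewrite (@ge0_gaussian_conv _ _ _ _ _ (tau k))//; last 3 first.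
- by rewrite gt_eqF.
- by rewrite gt_eqF.
- by rewrite gt_eqF.
by rewrite /f integral_indic// setIT.
Qed.

(** The law of (S, Xs) is a sum of two scaled laws, one carried by each label; it suffices to
    compare measures on sets, cut by the value of S. *)
Lemma ge0_integral_noisy (F : bool -> 'cV[R]_d -> \bar R) :
  (forall k, measurable_fun [set: 'cV[R]_d] (F k)) -> (forall k x, 0 <= F k x)%E ->
  (\int[P]_w F (S w) (Xs w) = p%:E * \int[nu true]_x F true x
    + (1 - p)%:E * \int[nu false]_x F false x)%E.
Proof.
move=> mF F0.
pose SX w := (S w, Xs w).
have mSX : measurable_fun [set: Omega] SX by exact: measurable_fun_pair.
pose g (bx : bool * 'cV[R]_d) := F bx.1 bx.2.
have mg : measurable_fun [set: bool * 'cV[R]_d] g.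
  rewrite (_ : g = (fun bx => if bx.1 then F true bx.2 else F false bx.2)); last first.
    by apply/funext => -[[] x].
  by apply: measurable_fun_ifT => //; apply: measurableT_comp.
have g0 y : (0 <= g y)%E by exact: F0.
have mpair (k : bool) : measurable_fun [set: 'cV[R]_d] (pair k) by exact: measurable_pair1.
transitivity (\int[pushforward P SX]_bx g bx)%E.
  by rewrite (ge0_integral_pushforwardT mSX P mg g0).
pose pairm (k : bool) : {mfun 'cV[R]_d >-> (bool * 'cV[R]_d)%type} :=
  HB.pack (pair k) (isMeasurableFun.Build _ _ _ _ _ (mpair k)).
transitivity (\int[measure_add
    (mscale (NngNum (ltW (pr_gt0 true))) (distribution (nu true) (pairm true)))
    (mscale (NngNum (ltW (pr_gt0 false))) (distribution (nu false) (pairm false)))]_bx g bx)%E.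
  apply: eq_measure_integral => A mA _.
  have mA_ k : measurable (pair k @^-1` A : set 'cV[R]_d).
    have mpairk : measurable_fun [set: 'cV[R]_d] (pair k) by exact: measurable_pair1.
    by rewrite -[X in measurable X]setTI; exact: mpairk.
  have mk k : measurable (Xs @^-1` (pair k @^-1` A) `&` S @^-1` [set k]).
    apply: measurableI; rewrite -[X in measurable X]setTI.
      by apply: measXs.
    by apply: measS.
  apply: esym; apply: (etrans (measure_addE _ _ A)); apply: esym.
  have partE k : mscale (NngNum (ltW (pr_gt0 k))) (distribution (nu k) (pairm k)) A =
      P (Xs @^-1` (pair k @^-1` A) `&` S @^-1` [set k]).
    exact: (esym (noisy_law k (mA_ k))).
  apply: (etrans _ (esym (f_equal2 (@adde R) (partE true) (partE false)))).
  have disj : (Xs @^-1` (pair true @^-1` A) `&` S @^-1` [set true])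
      `&` (Xs @^-1` (pair false @^-1` A) `&` S @^-1` [set false]) = set0.
    by apply/seteqP; split => w //= -[[_ ->] [_]].
  apply: (etrans _ (measureU P (mk true) (mk false) disj)).
  congr (P _); apply/seteqP; split => w /=.
    by rewrite /SX; case: (S w) => H; [left|right].
  by case => -[] /= H1 H2; rewrite /SX/= H2.
rewrite ge0_integral_measure_add//.
rewrite !ge0_integral_mscale//=.
by rewrite (ge0_integral_pushforwardT (mpair true) (nu true) mg g0)
  (ge0_integral_pushforwardT (mpair false) (nu false) mg g0).
Qed.

(** The L of the overview, kept as a sum over coordinates rather than expressed through [ccgA],
    [ccgb] and [ccgc]. *)
Definition log_odds (x : 'cV[R]_d) : R := ln (p / (1 - p)) +
  \sum_(i < d) log_density_ratio (mu false i 0) (tau false) (mu true i 0) (tau true) (x i 0).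

Lemma measurable_log_odds : measurable_fun [set: 'cV[R]_d] log_odds.
Proof.
apply: measurable_funD => //; apply: measurable_sum => i.
exact: (measurableT_comp (measurable_log_density_ratio _ _ _ _) (measurable_entry i 0)).
Qed.

Let eta0 x := sigmoid (log_odds x).

Let meta0 : measurable_fun [set: 'cV[R]_d] eta0.
Proof. exact: (measurableT_comp measurable_sigmoid measurable_log_odds). Qed.

Let eta0_ge0 x : 0 <= eta0 x. Proof. exact/ltW/sigmoid_gt0. Qed.

Let eta0_le1 x : 0 <= 1 - eta0 x. Proof. by rewrite subr_ge0 sigmoid_le1. Qed.

(** The class densities satisfy p f_1 = (1 - p) f_0 exp(L), so both classes can be integrated under
    [nu false]. *)
Let gaussian_reweight (g : 'cV[R]_d -> \bar R) :
  measurable_fun [set: 'cV[R]_d] g -> (forall x, 0 <= g x)%E ->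
  (p%:E * \int[nu true]_x g x =
   (1 - p)%:E * \int[nu false]_x (g x * (expR (log_odds x))%:E))%E.
Proof.
move=> mg g0.
have q0 : 0 < 1 - p by rewrite subr_gt0.
have pq : 0 < p / (1 - p) by rewrite divr_gt0.
have mL : measurable_fun [set: 'cV[R]_d] (fun x => (expR (\sum_(i < d)
    log_density_ratio (mu false i 0) (tau false) (mu true i 0) (tau true) (x i 0)))%:E).
  apply/measurable_EFinP; apply: measurableT_comp => //; apply: measurable_sum => i.
  exact: (measurableT_comp (measurable_log_density_ratio _ _ _ _) (measurable_entry i 0)).
transitivity (p%:E * \int[nu false]_x (g x * (expR (\sum_(i < d)
    log_density_ratio (mu false i 0) (tau false) (mu true i 0) (tau true) (x i 0)))%:E))%E.
  by congr (_ * _)%E; exact: (ge0_gaussian_change (mu false) (mu true)).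
rewrite [in RHS](eq_integral (fun x => (p / (1 - p))%:E * (g x * (expR (\sum_(i < d)
    log_density_ratio (mu false i 0) (tau false) (mu true i 0) (tau true) (x i 0)))%:E))%E); last first.
  by move=> x _; rewrite /log_odds expRD lnK ?posrE// EFinM muleCA.
rewrite ge0_integralZl//; last 3 first.
- exact: (emeasurable_funM mg mL).
- by move=> x _; rewrite mule_ge0// lee_fin expR_ge0.
- by rewrite lee_fin ltW.
by rewrite muleA -EFinM mulrC divfK// gt_eqF.
Qed.

Let mexp : measurable_fun [set: 'cV[R]_d] (fun x => (expR (log_odds x))%:E).
Proof.
by apply/measurable_EFinP; apply: measurableT_comp => //; exact: measurable_log_odds.
Qed.

Let ge0_integral_noisyE (F : bool -> 'cV[R]_d -> \bar R) :
  (forall k, measurable_fun [set: 'cV[R]_d] (F k)) -> (forall k x, 0 <= F k x)%E ->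
  (\int[P]_w F (S w) (Xs w) =
   (1 - p)%:E * \int[nu false]_x (F true x * (expR (log_odds x))%:E + F false x))%E.
Proof.
move=> mF F0; rewrite ge0_integral_noisy// gaussian_reweight//.
rewrite ge0_integralD//; last 2 first.
- by move=> x _; rewrite mule_ge0// lee_fin expR_ge0.
- exact: (emeasurable_funM (mF true) mexp).
rewrite [RHS]ge0_muleDr//; last exact: integral_ge0.
by apply: integral_ge0 => x _; rewrite mule_ge0// lee_fin expR_ge0.
Qed.

(** Bayes' formula. Under [nu false] the labels 1 and 0 carry weights exp(L) and 1, of which [eta0]
    and 1 - [eta0] are the normalizations; both sides reduce to the same integrand. *)
Lemma ge0_integral_posterior (f : bool -> 'cV[R]_d -> R) :
  (forall k, measurable_fun [set: 'cV[R]_d] (f k)) -> (forall k x, 0 <= f k x) ->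
  (\int[P]_w (f (S w) (Xs w))%:E =
   \int[P]_w (f true (Xs w) * eta0 (Xs w) + f false (Xs w) * (1 - eta0 (Xs w)))%:E)%E.
Proof.
move=> mf f0.
have mF k : measurable_fun [set: 'cV[R]_d] (fun x => (f k x)%:E) by exact/measurable_EFinP.
rewrite (ge0_integral_noisyE mF) => [|k x]; last by rewrite lee_fin.
pose g (k : bool) x := (f true x * eta0 x + f false x * (1 - eta0 x))%:E.
have mg k : measurable_fun [set: 'cV[R]_d] (g k).
  apply/measurable_EFinP; apply: measurable_funD; apply: measurable_funM => //.
  exact: measurable_funB.
rewrite (ge0_integral_noisyE mg) => [|k x]; last first.
  by rewrite lee_fin addr_ge0 ?mulr_ge0.
congr (_ * _)%E; apply: eq_integral => x _.
rewrite /g -!EFinM -!EFinD; congr (_%:E); rewrite /eta0 sigmoidE.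
have e1 : 1 + expR (log_odds x) != 0 by rewrite gt_eqF// ltr_pwDl// expR_ge0.
by field.
Qed.

(** Averaging over the label turns the square into e (1 - h)^2 + (1 - e) h^2 = (e - h)^2 + e (1 -
    e), with e the posterior. *)
Let mse_decomp (h : 'cV[R]_d -> R) : measurable_fun [set: 'cV[R]_d] h ->
  (\int[P]_w (((S w)%:R - h (Xs w)) ^+ 2)%:E =
   \int[P]_w ((eta0 (Xs w) - h (Xs w)) ^+ 2)%:E
   + \int[P]_w (eta0 (Xs w) * (1 - eta0 (Xs w)))%:E)%E.
Proof.
move=> mh.
rewrite (@ge0_integral_posterior (fun k x => (k%:R - h x) ^+ 2)); last 2 first.
- by move=> k; apply: measurable_funX; exact: measurable_funB.
- by move=> k x; exact: sqr_ge0.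
have meX : measurable_fun [set: Omega] (fun w => eta0 (Xs w)).
  exact: (measurableT_comp meta0 measXs).
have mhX : measurable_fun [set: Omega] (fun w => h (Xs w)).
  exact: (measurableT_comp mh measXs).
rewrite -ge0_integralD//; last 4 first.
- by move=> w _; rewrite lee_fin sqr_ge0.
- by apply/measurable_EFinP; apply: measurable_funX; exact: measurable_funB.
- by move=> w _; rewrite lee_fin mulr_ge0.
- by apply/measurable_EFinP; apply: measurable_funM => //; exact: measurable_funB.
by apply: eq_integral => w _; rewrite -EFinD; congr (_%:E) => /=; ring.
Qed.

(** Being only a version of the conditional expectation, [eta] is replaced by [eta0]: under the law
    of Xs both have the same integral over every measurable set, hence agree almost everywhere. *)
Let integral_regression (eta h : 'cV[R]_d -> R) :
  is_regression_function P (fun w => (S w)%:R) Xs eta ->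
  measurable_fun [set: 'cV[R]_d] h ->
  (\int[P]_w ((eta (Xs w) - h (Xs w)) ^+ 2)%:E =
   \int[P]_w ((eta0 (Xs w) - h (Xs w)) ^+ 2)%:E)%E.
Proof.
case=> meta ieta etaE mh.
have mdiff (e : 'cV[R]_d -> R) : measurable_fun [set: 'cV[R]_d] e ->
    measurable_fun [set: 'cV[R]_d] (fun x => ((e x - h x) ^+ 2)%:E).
  by move=> me; apply/measurable_EFinP; apply: measurable_funX; exact: measurable_funB.
have diff0 (e : 'cV[R]_d -> R) x : (0 <= ((e x - h x) ^+ 2)%:E)%E.
  by rewrite lee_fin sqr_ge0.
rewrite -(ge0_integral_pushforwardT measXs P (mdiff _ meta) (diff0 eta)).
rewrite -(ge0_integral_pushforwardT measXs P (mdiff _ meta0) (diff0 eta0)).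
apply: ge0_ae_eq_integral => //; [exact: mdiff|exact: mdiff|].
have mE_eta : measurable_fun [set: 'cV[R]_d] (EFin \o eta) by exact/measurable_EFinP.
have mE_eta0 : measurable_fun [set: 'cV[R]_d] (EFin \o eta0) by exact/measurable_EFinP.
have mpre E : measurable E -> measurable (Xs @^-1` E).
  by move=> mE; rewrite -[X in measurable X]setTI; exact: measXs.
have iE E : measurable E -> P.-integrable (Xs @^-1` E) ((EFin \o eta) \o Xs).
  by move=> mE; apply: (integrableS measurableT) => //; exact: mpre.
suff : ae_eq (pushforward P Xs) setT (EFin \o eta) (EFin \o eta0).
  by move=> /(_ measXs); apply: filterS => x /= /[apply] -[->].
move=> m; apply: integral_ae_eq => //.
  by apply: integrable_pushforward => //; exact: iE.
move=> E _ mE.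
rewrite (integral_pushforward m mE_eta (iE E mE) mE).
rewrite (ge0_integral_pushforward m P mE (measurable_funTS mE_eta0)); last first.
  by move=> y _; rewrite lee_fin.
rewrite [LHS]etaE// [LHS]integral_mkcond [RHS]integral_mkcond.
(* An indicator of Xs in place of the restricted domain makes the integrand a function of (S, Xs),
   as Bayes' formula requires. *)
transitivity (\int[P]_w ((S w)%:R * \1_E (Xs w))%:E)%E.
  apply: eq_integral => w _; rewrite patchE indicE.
  have -> : (w \in Xs @^-1` E) = (Xs w \in E) by apply/idP/idP; rewrite !inE.
  by case: ifP; rewrite ?mulr1 ?mulr0.
rewrite (@ge0_integral_posterior (fun k x => k%:R * \1_E x)); last 2 first.
- by move=> k; apply: measurable_funM => //; exact: measurable_indic.
- by move=> k x; rewrite mulr_ge0.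
apply: eq_integral => w _; rewrite patchE indicE.
have -> : (w \in Xs @^-1` E) = (Xs w \in E) by apply/idP/idP; rewrite !inE.
by case: ifP; rewrite /= ?mulr1 ?mulr0 ?mul1r ?mul0r ?addr0.
Qed.

Lemma measurable_logistic (h : 'cV[R]_d -> R) : logistic_class d h ->
  measurable_fun [set: 'cV[R]_d] h.
Proof.
case=> a [b ->]; apply: (measurableT_comp measurable_sigmoid).
apply: measurable_funD => //.
under eq_fun do rewrite /scal mxE.
apply: measurable_sum => i; apply: measurable_funM => //.
exact: measurable_entry.
Qed.

(** Both mean squared errors contain the integral of [eta0] (1 - [eta0]), which lies between 0 and
    1; being finite, it cancels from the minimality inequality. *)
Lemma approximation_error_le (eta hstar g : 'cV[R]_d -> R) :
  is_regression_function P (fun w => (S w)%:R) Xs eta ->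
  is_mse_minimizer P (fun w => (S w)%:R) Xs (logistic_class d) hstar ->
  logistic_class d g ->
  (approximation_error P Xs eta hstar <= \int[P]_w ((eta0 (Xs w) - g (Xs w)) ^+ 2)%:E)%E.
Proof.
move=> heta [Hh hmin] Hg.
have [mh mg] := (measurable_logistic Hh, measurable_logistic Hg).
have -> : approximation_error P Xs eta hstar =
    (\int[P]_w ((eta0 (Xs w) - hstar (Xs w)) ^+ 2)%:E)%E.
  by rewrite /approximation_error unlock; exact: integral_regression.
have := hmin g Hg; rewrite unlock !mse_decomp// leeD2rE//.
apply/fin_numPlt; apply/andP; split.
  apply: (@lt_le_trans _ _ 0%E); first exact: ltNyr.
  by apply: integral_ge0 => w _; rewrite lee_fin mulr_ge0.
apply: (@le_lt_trans _ _ (\int[P]_w (cst 1 w)))%E.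
  apply: ge0_le_integral => //.
  - by move=> w _; rewrite lee_fin mulr_ge0.
  - apply/measurable_EFinP; apply: measurable_funM.
      exact: (measurableT_comp meta0 measXs).
    by apply: measurable_funB => //; exact: (measurableT_comp meta0 measXs).
  - move=> w _; rewrite lee_fin mulr_ile1//; first exact: sigmoid_le1.
    by rewrite lerBlDr lerDl.
by rewrite integral_cst//= probability_setT mul1e ltry.
Qed.

Let N : R := \sum_(i < d) (mu true i 0 - mu false i 0) ^+ 2.
Let t k : R := sg k ^+ 2 + sigma ^+ 2.
Let al : R := 2^-1 * ((t false)^-1 - (t true)^-1).
Let Delta : R := al * d%:R * (t true - t false)
  + 2^-1 * ((t false)^-1 + (t true)^-1) * N.

(** Within class k the gap is its mean plus a centred quadratic, evaluated by [gaussian_moment]; the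
    last term is the variance between classes. [Delta] is the difference of the class means of L. *)
Lemma log_odds_affine_gap (om : R) : exists b : R,
  (\int[P]_w ((log_odds (Xs w) - (scal ((om *: mud mu)^T *m Xs w) + b)) ^+ 2)%:E
   = (p * (2 * al ^+ 2 * t true ^+ 2 * d%:R + t true * (((t false)^-1 - om) ^+ 2 * N))
      + (1 - p) * (2 * al ^+ 2 * t false ^+ 2 * d%:R + t false * (((t true)^-1 - om) ^+ 2 * N))
      + p * (1 - p) * (Delta - om * N) ^+ 2)%:E)%E.
Proof.
have t_gt0 k : 0 < t k by rewrite /t tau2 exprn_gt0.
have n0 : t false != 0 by rewrite gt_eqF.
have n1 : t true != 0 by rewrite gt_eqF.
pose dl i := mu true i 0 - mu false i 0.
(* At mu_k the class-k square vanishes, so the log-density ratio keeps only the square of the other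
   class, with this sign. *)
pose sgn (k : bool) : R := if k then 1 else -1.
pose e k := ln (p / (1 - p)) + \sum_(i < d) (ln (tau false / tau true) + al * t k
  + sgn k * dl i ^+ 2 / (2 * t (~~ k)) - om * dl i * mu k i 0).
(* [e k] is the mean of the gap in class k before centring; [b] is their average. *)
pose b := p * e true + (1 - p) * e false.
(* The gradient of the gap at mu_k; the class-k square is stationary there, hence the variance of
   the other class. *)
pose beta k : 'cV[R]_d := \col_i (((t (~~ k))^-1 - om) * dl i).
have eE : e true - e false = Delta - om * N.
  rewrite /e opprD addrACA subrr add0r -sumrB /Delta.
  rewrite (_ : al * d%:R * (t true - t false) = \sum_(i < d) (al * (t true - t false))); last first.
    by rewrite sumr_const card_ord -(mulr_natr _ d); ring.
  rewrite /N !mulr_sumr -big_split/= -sumrB; apply: eq_bigr => i _.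
  by rewrite /sgn /dl; field; rewrite n0 n1.
exists b.
pose F (k : bool) (x : 'cV[R]_d) :=
  ((log_odds x - (scal ((om *: mud mu)^T *m x) + b)) ^+ 2)%:E.
have FE k x : F k x = ((\sum_(i < d) (al * ((x i 0 - mu k i 0) ^+ 2 - tau k ^+ 2)
    + beta k i 0 * (x i 0 - mu k i 0)) + (e k - b)) ^+ 2)%:E.
  rewrite /F /log_odds /scal mxE; congr ((_ ^+ 2)%:E).
  set ldr := \sum_i log_density_ratio _ _ _ _ _; set lin := \sum_j _; set quad := \sum_i _.
  have H : ldr - lin = quad + \sum_(i < d) (ln (tau false / tau true) + al * t k
      + sgn k * dl i ^+ 2 / (2 * t (~~ k)) - om * dl i * mu k i 0).
    rewrite /ldr /lin /quad -sumrB -big_split/=; apply: eq_bigr => i _.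
    rewrite /log_density_ratio -!tau2 -!/(t _) !mxE -/(dl i) /sgn.
    clear ldr lin quad; rewrite /dl /al.
    by case: k => /=; field; rewrite n0 n1.
  rewrite (_ : _ - (lin + b) = ln (p / (1 - p)) + (ldr - lin) - b); last by ring.
  by rewrite H /e; ring.
have mF k : measurable_fun [set: 'cV[R]_d] (F k).
  apply/measurable_EFinP; apply: measurable_funX; apply: measurable_funB.
    exact: measurable_log_odds.
  apply: measurable_funD => //; under eq_fun do rewrite /scal mxE.
  by apply: measurable_sum => i; apply: measurable_funM => //; exact: measurable_entry.
have F0 k x : (0 <= F k x)%E by rewrite lee_fin sqr_ge0.
have IF k : (\int[nu k]_x F k x = (2 * al ^+ 2 * tau k ^+ 4 * d%:R
    + tau k ^+ 2 * \sum_(i < d) beta k i 0 ^+ 2 + (e k - b) ^+ 2)%:E)%E.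
  under eq_integral do rewrite FE.
  by apply: gaussian_moment; rewrite gt_eqF.
have tau4 k : tau k ^+ 4 = t k ^+ 2 by rewrite (exprM _ 2 2) -tau2.
have betaE k : \sum_(i < d) beta k i 0 ^+ 2 = ((t (~~ k))^-1 - om) ^+ 2 * N.
  by rewrite /N mulr_sumr; apply: eq_bigr => i _; rewrite mxE exprMn.
rewrite (ge0_integral_noisy mF F0) !IF -!EFinM -EFinD !tau4 !betaE -!tau2.
(* The class means deviate from [b] by (1 - p) (e true - e false) and -p (e true - e false), which
   produces the factor p (1 - p). *)
congr (_%:E); rewrite -eE /b /=.
by rewrite -/(t true) -/(t false); ring.
Qed.

Lemma approximation_error_bound (om : R) (eta hstar : 'cV[R]_d -> R) :
  is_regression_function P (fun w => (S w)%:R) Xs eta ->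
  is_mse_minimizer P (fun w => (S w)%:R) Xs (logistic_class d) hstar ->
  (approximation_error P Xs eta hstar <= (4^-1 *
     (p * (2 * al ^+ 2 * t true ^+ 2 * d%:R + t true * (((t false)^-1 - om) ^+ 2 * N))
      + (1 - p) * (2 * al ^+ 2 * t false ^+ 2 * d%:R + t false * (((t true)^-1 - om) ^+ 2 * N))
      + p * (1 - p) * (Delta - om * N) ^+ 2))%:E)%E.
Proof.
move=> heta hmin; have [b gapE] := log_odds_affine_gap om.
pose g (x : 'cV[R]_d) := sigmoid (scal ((om *: mud mu)^T *m x) + b).
have Hg : logistic_class d g by exists (om *: mud mu), b.
have mg := measurable_logistic Hg.
have maff : measurable_fun [set: 'cV[R]_d] (fun x => scal ((om *: mud mu)^T *m x) + b).
  apply: measurable_funD => //; under eq_fun do rewrite /scal mxE.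
  by apply: measurable_sum => i; apply: measurable_funM => //; exact: measurable_entry.
have mgap : measurable_fun [set: Omega]
    (fun w => ((log_odds (Xs w) - (scal ((om *: mud mu)^T *m Xs w) + b)) ^+ 2)%:E).
  apply/measurable_EFinP; apply: measurable_funX; apply: measurable_funB.
    exact: (measurableT_comp measurable_log_odds measXs).
  exact: (measurableT_comp maff measXs).
apply: (le_trans (approximation_error_le heta hmin Hg)).
rewrite EFinM -gapE -ge0_integralZl//; last by move=> w _; rewrite lee_fin sqr_ge0.
apply: ge0_le_integral => //.
- by move=> w _; rewrite lee_fin sqr_ge0.
- apply/measurable_EFinP; apply: measurable_funX; apply: measurable_funB.
    exact: (measurableT_comp meta0 measXs).
  exact: (measurableT_comp mg measXs).
- exact: measurable_funeM.
- by move=> w _; rewrite -EFinM lee_fin; exact: sigmoid_lipschitz.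
Qed.

End noisy_mixture.

(** * Evaluation of eps_CCG *)

Section ccg_algebra.
Context {R : realType} (d : nat) (p sigma : R).
Context (mu : bool -> 'cV[R]_d) (sg : bool -> R).
Hypotheses (p_gt0 : 0 < p) (p_lt1 : p < 1).
Hypothesis hsg : forall k, 0 < sg k.

Let t (k : bool) : R := sg k ^+ 2 + sigma ^+ 2.
Let t0 := t false.
Let t1 := t true.
Let N : R := \sum_(i < d) (mu true i 0 - mu false i 0) ^+ 2.
Let q : R := 1 - p.
Let al : R := 2^-1 * (t0^-1 - t1^-1).
Let Delta : R := al * d%:R * (t1 - t0) + 2^-1 * (t0^-1 + t1^-1) * N.
Let w : R := p * t1 + q * t0 + p * q * N.
Let kappa : R := p * t1 / t0 + q * t0 / t1 + p * q * Delta.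
Let Var : R := p * (2 * d%:R * al ^+ 2 * t1 ^+ 2 + t1 * N / t0 ^+ 2)
  + q * (2 * d%:R * al ^+ 2 * t0 ^+ 2 + t0 * N / t1 ^+ 2) + p * q * Delta ^+ 2.

Let t_gt0 k : 0 < t k.
Proof. by rewrite ltr_pwDl ?exprn_gt0// sqr_ge0. Qed.

Let t0_gt0 : 0 < t0. Proof. exact: t_gt0. Qed.
Let t1_gt0 : 0 < t1. Proof. exact: t_gt0. Qed.

Let N_ge0 : 0 <= N. Proof. by apply: sumr_ge0 => i _; exact: sqr_ge0. Qed.

Let q_gt0 : 0 < q. Proof. by rewrite subr_gt0. Qed.

Let v_gt0 : 0 < p * t1 + q * t0.
Proof. by apply: addr_gt0; exact: mulr_gt0. Qed.

Let w_gt0 : 0 < w.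
Proof. by apply: ltr_pwDl; rewrite ?mulr_ge0 ?N_ge0// ltW// mulr_gt0. Qed.

Let scD n (a b : R) : (a + b)%:M = a%:M + b%:M :> 'M[R]_n.
Proof. by apply/matrixP => i j; rewrite !mxE mulrnDl. Qed.
Let scN n (a : R) : (- a)%:M = - a%:M :> 'M[R]_n.
Proof. by apply/matrixP => i j; rewrite !mxE mulNrn. Qed.

Let tSigE k : tSig d sg sigma k = (t k)%:M.
Proof. by rewrite /tSig /Sig -scD. Qed.

Let ccgAE : ccgA d sg sigma = al%:M.
Proof.
by rewrite /ccgA !tSigE !invmx_scalar -scN -scD scale_scalar_mx.
Qed.

Let ccgbE : ccgb mu sg sigma = t1^-1 *: mu true - t0^-1 *: mu false.
Proof. by rewrite /ccgb !tSigE !invmx_scalar !mul_scalar_mx. Qed.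

Let dot (x y : 'cV[R]_d) : R := \sum_(i < d) x i 0 * y i 0.

Let scalE (x y : 'cV[R]_d) : scal (x^T *m y) = dot x y.
Proof. by rewrite /scal mxE; apply: eq_bigr => i _; rewrite mxE. Qed.

Let trmx_mulE (x y : 'cV[R]_d) : x^T *m y = (dot x y)%:M.
Proof. by rewrite [LHS]mx11_scalar -/(scal _) scalE. Qed.

Let dotDl x y z : dot (x + y) z = dot x z + dot y z.
Proof. by rewrite -big_split; apply: eq_bigr => i _; rewrite mxE mulrDl. Qed.
Let dotZl a x z : dot (a *: x) z = a * dot x z.
Proof. by rewrite mulr_sumr; apply: eq_bigr => i _; rewrite mxE mulrA. Qed.
Let dotC x y : dot x y = dot y x.
Proof. by apply: eq_bigr => i _; rewrite mulrC. Qed.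
Let dotNl x z : dot (- x) z = - dot x z.
Proof. by rewrite -scaleN1r dotZl mulN1r. Qed.

Let mm (j k : bool) := dot (mu j) (mu k).

Let NE : N = mm true true - 2 * mm true false + mm false false.
Proof.
rewrite /N /mm /dot mulr_sumr -sumrB -big_split; apply: eq_bigr => i _ /=.
by ring.
Qed.

Let mud_dot : dot (mud mu) (mud mu) = N.
Proof. by apply: eq_bigr => i _; rewrite !mxE expr2. Qed.

Let withinE : p *: Sig d sg true + q *: Sig d sg false + (sigma ^+ 2)%:M
  = (p * t1 + q * t0)%:M.
Proof.
rewrite /Sig !scale_scalar_mx -!scD; congr (_%:M).
by rewrite /t1 /t0 /t /q; ring.
Qed.

Let VAR2E : ccgVAR2 p mu sg sigma =
  (p * t1 + q * t0)%:M + (p * q) *: (mud mu *m (mud mu)^T).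
Proof. by rewrite /ccgVAR2 addrAC withinE. Qed.

Let VAR2_mud : ccgVAR2 p mu sg sigma *m mud mu = w *: mud mu.
Proof.
rewrite VAR2E mulmxDl mul_scalar_mx -scalemxAl -mulmxA trmx_mulE mud_dot.
by rewrite mul_mx_scalar scalerA -scalerDl.
Qed.

(** The explicit inverse is the Sherman-Morrison formula for a rank-one update of a scalar
    matrix. *)
Let VAR2_unit : ccgVAR2 p mu sg sigma \in unitmx.
Proof.
pose v := p * t1 + q * t0.
have v0 : v != 0 by rewrite gt_eqF.
have w0 : w != 0 by rewrite gt_eqF.
apply: (proj1 (mulmx1_unit (B := v^-1%:M - (p * q / (v * w)) *: (mud mu *m (mud mu)^T)) _)).
rewrite mulmxBr -scalemxAr mulmxA VAR2_mud -scalemxAl scalerA.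
rewrite mul_mx_scalar VAR2E scalerDr scalerA scale_scalar_mx mulVf//.
rewrite (_ : p * q / (v * w) * w = v^-1 * (p * q)); last by field; rewrite w0 v0.
by rewrite addrK.
Qed.

Let invVAR2_mud : invmx (ccgVAR2 p mu sg sigma) *m mud mu = w^-1 *: mud mu.
Proof.
have w0 : w != 0 by rewrite gt_eqF.
apply: (canRL (scalerK w0)).
by rewrite scalemxAr -VAR2_mud mulmxA mulVmx// mul1mx.
Qed.

Let qE k : scal ((mu k)^T *m al%:M *m mu k) = al * mm k k.
Proof. by rewrite mul_mx_scalar -scalemxAl /scal mxE -/(scal _) scalE. Qed.

Let COVE : ccgCOV p mu sg sigma = kappa *: (mud mu)^T.
Proof.
have n0 : t0 != 0 by rewrite gt_eqF.
have n1 : t1 != 0 by rewrite gt_eqF.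
(* Writing sg_k^2 as t_k - sigma^2 lets the separate sigma^2 terms of [ccgCOV] cancel, leaving an
   entrywise rational identity. *)
have E1 : sg true ^+ 2 = t1 - sigma ^+ 2 by rewrite /t1 /t addrK.
have E0 : sg false ^+ 2 = t0 - sigma ^+ 2 by rewrite /t0 /t addrK.
have classE k : (mu k)^T *m al%:M *m Sig d sg k = (sg k ^+ 2 * al) *: (mu k)^T.
  by rewrite !mul_mx_scalar scalerA.
have meanE : (p *: mu true + q *: mu false)^T *m al%:M
    = al *: (p *: mu true + q *: mu false)^T by rewrite mul_mx_scalar.
have trE : \tr (al%:M *m (Sig d sg true - Sig d sg false)) = al * (t1 - t0) * d%:R.
  by rewrite /Sig -scN -scD -scalar_mxM mxtrace_scalar E1 E0 -(mulr_natr _ d); ring.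
have bE : (ccgb mu sg sigma)^T *m (p *: Sig d sg true + q *: Sig d sg false
      + (sigma ^+ 2)%:M + (p * q) *: (mud mu *m (mud mu)^T)) =
    (p * t1 + q * t0) *: (ccgb mu sg sigma)^T
    + (p * q * dot (ccgb mu sg sigma) (mud mu)) *: (mud mu)^T.
  by rewrite withinE mulmxDr mul_mx_scalar -scalemxAr mulmxA trmx_mulE mul_scalar_mx scalerA.
have dE : dot (ccgb mu sg sigma) (mud mu) =
    t1^-1 * (mm true true - mm true false) - t0^-1 * (mm true false - mm false false).
  rewrite ccgbE /mud dotDl dotNl !dotZl !(dotC _ (_ - _)) !dotDl !dotNl.
  by rewrite /mm (dotC (mu false) (mu true)); ring.
rewrite /ccgCOV ccgAE !classE meanE trE !qE bE dE ccgbE.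
apply/rowP => i; rewrite !mxE E1 E0 /kappa /q /Delta NE /al.
by field; rewrite n0 n1.
Qed.

(** * Evaluation for arbitrary spectral data *)

Section spectral.
Context (T Q : bool -> 'M[R]_d) (lam : bool -> 'rV[R]_d).
Hypothesis hspec : is_ccg_spectral_data sg sigma T Q lam.

Let TT k : T k *m T k = (t k)%:M.
Proof. by have [[_ _ ->] _] := hspec k; exact: tSigE. Qed.

Let QQ k : (Q k)^T *m Q k = 1%:M. Proof. by have [_ []] := hspec k. Qed.

(** As [ccgA] is scalar, T A T is a multiple of T^2 = t_k I, hence scalar, and conjugation by an
    orthogonal matrix leaves it unchanged. *)
Let lamE k j : lam k 0 j = al * t k.
Proof.
have [_ [_ BQ]] := hspec k.
have E : T k *m ccgA d sg sigma *m T k = (al * t k)%:M.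
  by rewrite ccgAE mul_mx_scalar -scalemxAl TT scale_scalar_mx.
have : diag_mx (lam k) = (al * t k)%:M.
  rewrite -[LHS]mul1mx -(QQ k) -mulmxA -BQ E mulmxA mul_mx_scalar -scalemxAl QQ.
  by rewrite scale_scalar_mx mulr1.
by move/matrixP => /(_ j j); rewrite !mxE eqxx !mulr1n.
Qed.

(** The orthogonal factor preserves the norm and T^2 = t_k I, so the value is the same for every
    choice of eigenvectors. *)
Let normu k : \sum_(j < d) ccgu mu sg sigma T Q k j 0 ^+ 2 =
  t k * dot (ccgb mu sg sigma + 2 *: (ccgA d sg sigma *m mu k))
            (ccgb mu sg sigma + 2 *: (ccgA d sg sigma *m mu k)).
Proof.
set z := _ + _.
transitivity (scal ((ccgu mu sg sigma T Q k)^T *m ccgu mu sg sigma T Q k)).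
  by rewrite scalE; apply: eq_bigr => j _; rewrite expr2.
have [[Tsym _ _] _] := hspec k.
rewrite /ccgu -/z !trmx_mul trmxK Tsym.
rewrite -!mulmxA (mulmxA (Q k)) (mulmx1C (QQ k)) mul1mx (mulmxA (T k)) TT.
by rewrite mul_scalar_mx -scalemxAr /scal mxE -/(scal _) scalE.
Qed.

Let VE k : ccgV mu sg sigma T Q lam k =
  2 * d%:R * al ^+ 2 * t k ^+ 2 + t k * N / t (~~ k) ^+ 2.
Proof.
have n0 : t0 != 0 by rewrite gt_eqF.
have n1 : t1 != 0 by rewrite gt_eqF.
rewrite /ccgV big_split/= normu.
under eq_bigr do rewrite lamE.
rewrite sumr_const card_ord -(mulr_natr _ d); congr (_ + _); first by ring.
(* This is the gradient of L at mu_k. *)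
have -> : ccgb mu sg sigma + 2 *: (ccgA d sg sigma *m mu k) = (t (~~ k))^-1 *: mud mu.
  rewrite ccgbE ccgAE mul_scalar_mx /mud; apply/colP => i; rewrite !mxE.
  by case: k => /=; rewrite -/t0 -/t1 /al; field; rewrite n0 n1.
rewrite dotZl dotC dotZl mud_dot.
have nk : t (~~ k) != 0 by rewrite gt_eqF.
by field.
Qed.

(** Taking the difference cancels the common [ccgc], with its logarithms, and leaves a rational
    identity. *)
Let MdiffE : ccgM p mu sg sigma lam true - ccgM p mu sg sigma lam false = Delta.
Proof.
have n0 : t0 != 0 by rewrite gt_eqF.
have n1 : t1 != 0 by rewrite gt_eqF.
rewrite /ccgM; under eq_bigr do rewrite lamE.
under [X in _ - (X + _ + _ + _)]eq_bigr do rewrite lamE.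
rewrite !sumr_const card_ord -(mulr_natr (al * t true)) -(mulr_natr (al * t false)).
rewrite ccgAE !qE !scalE.
rewrite ccgbE !dotDl !dotNl !dotZl -!/(mm _ _) (_ : mm false true = mm true false); last exact: dotC.
by rewrite /Delta NE /al -/t0 -/t1; field; rewrite n0 n1.
Qed.

Lemma eps_CCG_closed_form :
  eps_CCG p mu sg sigma T Q lam = 4^-1 * (Var - kappa ^+ 2 * N / w).
Proof.
rewrite /eps_CCG; congr (_ * (_ - _)).
  by rewrite /ccgVAR1 !VE MdiffE.
rewrite COVE [(_ *: _)^T]linearZ/= trmxK -mulmxA -scalemxAr invVAR2_mud.
rewrite scalerA -scalemxAl -scalemxAr trmx_mulE mud_dot scalerA /scal !mxE mulr1n.
by ring.
Qed.

End spectral.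

End ccg_algebra.

(** * Closed forms *)

Section closed_forms.
Context {R : realType}.

(** Origin of the r_i: expansion of t_0^2 t_1^2 w in powers of the noise variance. *)
Lemma ccg_denominator (p n s0 s1 s : R) :
  r1 p n s0 s1 + r2 p n s0 s1 * s ^+ 2 + r3 p n s0 s1 * s ^+ 4
    + r4 p n s0 s1 * s ^+ 6 + r5 p n s0 s1 * s ^+ 8 + s ^+ 10
  = (s0 ^+ 2 + s ^+ 2) ^+ 2 * (s1 ^+ 2 + s ^+ 2) ^+ 2
    * (p * (s1 ^+ 2 + s ^+ 2) + (1 - p) * (s0 ^+ 2 + s ^+ 2) + p * (1 - p) * n ^+ 2).
Proof. by rewrite /r1 /r2 /r3 /r4 /r5; ring. Qed.

Lemma ccg_numerator (d : nat) (p n s0 s1 s : R) :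
  c1 p s0 s1 s * d%:R ^+ 2 + c2 p n s0 s1 s * d%:R + c3 p n s0 s1 s
  = (s1 ^+ 2 - s0 ^+ 2) ^+ 2
    * (q1 d p n s0 s1 + q2 d p n s0 s1 * s ^+ 2 + q3 d p n s0 s1 * s ^+ 4 + 2 * d%:R * s ^+ 6).
Proof. by rewrite /c1 /c2 /c3 /q1 /q2 /q3; ring. Qed.

(** Here [w] stays a free variable, which keeps the field identity small; its value enters only in
    the numerator. The quantity [u] is 2 t_0 t_1 [Delta]. *)
Lemma ccg_fraction (D p N t0 t1 w : R) : t0 != 0 -> t1 != 0 -> w != 0 ->
  let q := 1 - p in
  let al := 2^-1 * (t0^-1 - t1^-1) in
  let Delta := al * D * (t1 - t0) + 2^-1 * (t0^-1 + t1^-1) * N in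
  let kappa := p * t1 / t0 + q * t0 / t1 + p * q * Delta in
  let Var := p * (2 * D * al ^+ 2 * t1 ^+ 2 + t1 * N / t0 ^+ 2)
    + q * (2 * D * al ^+ 2 * t0 ^+ 2 + t0 * N / t1 ^+ 2) + p * q * Delta ^+ 2 in
  let u := D * (t1 - t0) ^+ 2 + N * (t1 + t0) in
  4^-1 * (Var - kappa ^+ 2 * N / w) =
  (w * (2 * p * (D * (t1 - t0) ^+ 2 * t1 ^+ 2 + 2 * t1 ^+ 3 * N)
        + 2 * q * (D * (t1 - t0) ^+ 2 * t0 ^+ 2 + 2 * t0 ^+ 3 * N) + p * q * u ^+ 2)
   - (2 * p * t1 ^+ 2 + 2 * q * t0 ^+ 2 + p * q * u) ^+ 2 * N)
  / (16 * (t0 ^+ 2 * t1 ^+ 2 * w)).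
Proof. by move=> n0 n1 nw /=; field; rewrite n0 n1 nw. Qed.

(** The factor (s1^2 - s0^2)^2 reflects that L is itself affine when the two variances coincide. *)
Lemma ccg_fraction_numerator (d : nat) (p n s0 s1 s : R) :
  let t0 := s0 ^+ 2 + s ^+ 2 in
  let t1 := s1 ^+ 2 + s ^+ 2 in
  let q := 1 - p in
  let w := p * t1 + q * t0 + p * q * n ^+ 2 in
  let u := d%:R * (t1 - t0) ^+ 2 + n ^+ 2 * (t1 + t0) in
  w * (2 * p * (d%:R * (t1 - t0) ^+ 2 * t1 ^+ 2 + 2 * t1 ^+ 3 * n ^+ 2)
        + 2 * q * (d%:R * (t1 - t0) ^+ 2 * t0 ^+ 2 + 2 * t0 ^+ 3 * n ^+ 2) + p * q * u ^+ 2)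
   - (2 * p * t1 ^+ 2 + 2 * q * t0 ^+ 2 + p * q * u) ^+ 2 * n ^+ 2
  = (s1 ^+ 2 - s0 ^+ 2) ^+ 2
    * (q1 d p n s0 s1 + q2 d p n s0 s1 * s ^+ 2 + q3 d p n s0 s1 * s ^+ 4 + 2 * d%:R * s ^+ 6).
Proof. by move=> /=; rewrite /q1 /q2 /q3; ring. Qed.

Lemma ccg_optimal_gap (D p N t0 t1 : R) : t0 != 0 -> t1 != 0 ->
  let q := 1 - p in
  let w := p * t1 + q * t0 + p * q * N in
  let al := 2^-1 * (t0^-1 - t1^-1) in
  let Delta := al * D * (t1 - t0) + 2^-1 * (t0^-1 + t1^-1) * N in
  let kappa := p * t1 / t0 + q * t0 / t1 + p * q * Delta in
  let Var := p * (2 * D * al ^+ 2 * t1 ^+ 2 + t1 * N / t0 ^+ 2)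
    + q * (2 * D * al ^+ 2 * t0 ^+ 2 + t0 * N / t1 ^+ 2) + p * q * Delta ^+ 2 in
  let om := kappa / w in
  w != 0 ->
  p * (2 * al ^+ 2 * t1 ^+ 2 * D + t1 * ((t0^-1 - om) ^+ 2 * N))
    + q * (2 * al ^+ 2 * t0 ^+ 2 * D + t0 * ((t1^-1 - om) ^+ 2 * N))
    + p * q * (Delta - om * N) ^+ 2
  = Var - kappa ^+ 2 * N / w.
Proof.
move=> n0 n1 q w al Delta kappa Var om nw.
(* As a function of om the gap is quadratic, minimal at om = kappa / w. *)
transitivity (Var - 2 * om * N * kappa + om ^+ 2 * N * w).
  by rewrite /w /Var /kappa; field; rewrite n0 n1.
by rewrite /om; field.
Qed.

End closed_forms.

Theorem corollary1 (R : realType) (disp : measure_display)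
    (Omega : measurableType disp) (P : probability Omega R)
    (d : nat) (p sigma : R) (mu : bool -> 'cV[R]_d) (sg : bool -> R)
    (S : {RV P >-> bool}) (X Z : {RV P >-> 'cV[R]_d})
    (eta hstar : 'cV[R]_d -> R)
    (T Q : bool -> 'M[R]_d) (lam : bool -> 'rV[R]_d)
    (hd : (1 <= d)%N) (hp : 0 < p < 1)
    (hsg : forall k, 0 < sg k) (hsigma : 0 < sigma)
    (hS : forall B : set bool, P (S @^-1` B) = bernoulli_prob p B)
    (hX : forall (k : bool) (B : set 'cV[R]_d), measurable B ->
       (cond_prob P (X @^-1` B) (S @^-1` [set k]))%:E
       = mvnormal (mu k) ((sg k ^+ 2)%:M) B)
    (hZ : forall B : set 'cV[R]_d, measurable B ->
       P (Z @^-1` B) = mvnormal 0 1%:M B)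
    (hZind : independent P Z (fun w => (X w, S w)))
    (heta : is_regression_function P (fun w => (S w)%:R) (noisy sigma X Z) eta)
    (hhstar : is_mse_minimizer P (fun w => (S w)%:R) (noisy sigma X Z)
       (logistic_class d) hstar)
    (hspec : is_ccg_spectral_data sg sigma T Q lam) :
  let n := enorm (mu true - mu false) in
  let s0 := sg false in
  let s1 := sg true in
  let eps := eps_CCG p mu sg sigma T Q lam in
  [/\ (approximation_error P (noisy sigma X Z) eta hstar <= eps%:E)%E,
      eps = (s1 ^+ 2 - s0 ^+ 2) ^+ 2
            * (q1 d p n s0 s1 + q2 d p n s0 s1 * sigma ^+ 2
               + q3 d p n s0 s1 * sigma ^+ 4 + 2 * d%:R * sigma ^+ 6)
            / (16 * (r1 p n s0 s1 + r2 p n s0 s1 * sigma ^+ 2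
               + r3 p n s0 s1 * sigma ^+ 4 + r4 p n s0 s1 * sigma ^+ 6
               + r5 p n s0 s1 * sigma ^+ 8 + sigma ^+ 10)) &
      eps = (c1 p s0 s1 sigma * d%:R ^+ 2 + c2 p n s0 s1 sigma * d%:R
             + c3 p n s0 s1 sigma) / c4 p n s0 s1 sigma].
Proof.
move=> n s0 s1 eps; have /andP[p_gt0 p_lt1] := hp.
pose t0 := s0 ^+ 2 + sigma ^+ 2; pose t1 := s1 ^+ 2 + sigma ^+ 2.
have t0_gt0 : 0 < t0 by rewrite ltr_pwDl ?exprn_gt0 ?sqr_ge0// hsg.
have t1_gt0 : 0 < t1 by rewrite ltr_pwDl ?exprn_gt0 ?sqr_ge0// hsg.
have q_gt0 : 0 < 1 - p by rewrite subr_gt0.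
have n0 : t0 != 0 by rewrite gt_eqF.
have n1 : t1 != 0 by rewrite gt_eqF.
have n2 : n ^+ 2 = \sum_(i < d) (mu true i 0 - mu false i 0) ^+ 2.
  rewrite sqr_sqrtr; last by apply: sumr_ge0 => i _; exact: sqr_ge0.
  by apply: eq_bigr => i _; rewrite !mxE.
pose w := p * t1 + (1 - p) * t0 + p * (1 - p) * n ^+ 2.
have w_gt0 : 0 < w.
  apply: ltr_pwDl; first by apply: addr_gt0; exact: mulr_gt0.
  by rewrite mulr_ge0 ?sqr_ge0// mulr_ge0 ?ltW.
have nw : w != 0 by rewrite gt_eqF.
have epsE := eps_CCG_closed_form mu p_gt0 p_lt1 hsg hspec.
rewrite /= -n2 -/s0 -/s1 -/t0 -/t1 -/w -/eps in epsE.
have closedE : eps = (s1 ^+ 2 - s0 ^+ 2) ^+ 2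
    * (q1 d p n s0 s1 + q2 d p n s0 s1 * sigma ^+ 2
       + q3 d p n s0 s1 * sigma ^+ 4 + 2 * d%:R * sigma ^+ 6)
    / (16 * (r1 p n s0 s1 + r2 p n s0 s1 * sigma ^+ 2
       + r3 p n s0 s1 * sigma ^+ 4 + r4 p n s0 s1 * sigma ^+ 6
       + r5 p n s0 s1 * sigma ^+ 8 + sigma ^+ 10)).
  rewrite epsE (ccg_fraction _ _ _ n0 n1 nw) ccg_denominator.
  by congr (_ / _); exact: ccg_fraction_numerator.
split => //; last by rewrite closedE /c4 ccg_numerator.
pose al := 2^-1 * (t0^-1 - t1^-1).
pose Delta := al * d%:R * (t1 - t0) + 2^-1 * (t0^-1 + t1^-1) * n ^+ 2.
pose kappa := p * t1 / t0 + (1 - p) * t0 / t1 + p * (1 - p) * Delta.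
apply: (le_trans (approximation_error_bound p_gt0 p_lt1 hsg hsigma hS hX hZ hZind
  (kappa / w) heta hhstar)).
(* At the slope kappa / w the upper bound equals [eps], so the inequality is proved as an
   equality. *)
rewrite lee_fin epsE -n2 le_eqVlt; apply/orP; left; apply/eqP.
by congr (_ * _); exact: ccg_optimal_gap.
Qed.
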